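(* For any matrices $(A,R,S)$ satisfying the rank condition stated in the context, the function $h_0(x)=\exp(-\frac12x'Q_\infty x)$ is the ground state of the Hamiltonian $\mathcal{H}$, in the sense that $$\mathcal{H}(h_0)=\lambda_0\,h_0\quad\text{with}\quad \lambda_0:=\tfrac12\mathrm{Tr}(SP_\infty)=\tfrac12\mathrm{Tr}(RQ_\infty)>0.$$ In addition, for every $t\ge0$, $$e^{\lambda_0t}\,\mathcal{K}_t(x,dy)=h_0(x)\,\mathcal{K}^h_t(x,dy)\,h_0^{-1}(y),\qquad h_0^{-1}(y):=1/h_0(y).$$
   Context: Setting: $r\ge1$; $A,R,S$ are real $r\times r$ matrices, $R,S$ symmetric positive semi-definite; $'$ denotes transposition. Rank condition: the matrices $[R^{1/2},AR^{1/2},\ldots,A^{r-1}R^{1/2}]$ and $[S^{1/2},A'S^{1/2},\ldots,(A')^{r-1}S^{1/2}]$ both have rank $r$. Under this condition let $P_\infty$ be the unique positive definite solution of $AP+PA'+R-PSP=0$ and $Q_\infty$ the unique positive definite solution of $A'Q+QA-QRQ+S=0$. The Hamiltonian is $\mathcal{H}=-\mathcal{L}+V$ with $V(x)=\frac12x'Sx$ and $\mathcal{L}f(x)=(Ax)'\nabla f(x)+\frac12\mathrm{Tr}(R\nabla^2f(x))$. Let $B$ be an $r\times r_1$ matrix with $BB'=R$, $W_t$ an $r_1$-dimensional Brownian motion, $dX_t=AX_t\,dt+B\,dW_t$. The Feynman-Kac propagator is $\mathcal{K}_t(f)(x)=\int\mathcal{K}_t(x,dy)f(y)=\mathbb{E}\big(f(X_t)\exp(-\int_0^tV(X_u)du)\mid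 X_0=x\big)$. The $h$-process solves $dX^h_t=(A-RQ_\infty)X^h_t\,dt+B\,dW_t$ and has transition kernel $\mathcal{K}^h_t(x,dy)=\mathbb{P}(X^h_t\in dy\mid X^h_0=x)$. *)

(* Defs.v *)
(* MathComp-Analysis; the reals are an arbitrary [R : realType].  The
   coefficient matrices (A, R, S) of the model are called (A, Rm, Sm), and
   vectors of R^n are column vectors ['cV[R]_n]. *)
From HB Require Import structures.
From mathcomp Require Import all_boot all_order all_algebra.
From mathcomp Require Import all_classical all_reals all_analysis.

Set Implicit Arguments.
Unset Strict Implicit.
Unset Printing Implicit Defensive.

Import Order.TTheory GRing.Theory Num.Theory.
Import numFieldNormedType.Exports.

Local Open Scope classical_set_scope.
Local Open Scope ring_scope.

Section Matrices.
Variables (R : realType) (r : nat).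
Implicit Types (A P Q M Rm Sm : 'M[R]_r) (x : 'cV[R]_r).

Definition quad_form M x : R := (x^T *m M *m x) 0 0.

Definition psdmx M : Prop := M^T = M /\ forall x, 0 <= quad_form M x.

Definition pdmx M : Prop := M^T = M /\ forall x, x != 0 -> 0 < quad_form M x.

Definition psd_sqrt Mh M : Prop := psdmx Mh /\ Mh *m Mh = M.

(* [M, A M, ..., A^(r-1) M], an r x (r * r) matrix. *)
Definition kalman_mx A M := \mxrow_(k < r) (A ^+ k *m M).

(* A psd matrix has exactly one psd square root, so the existentials below only
   name R^(1/2) and S^(1/2). *)
Definition rank_condition A Rm Sm : Prop :=
  (exists Rh, psd_sqrt Rh Rm /\ \rank (kalman_mx A Rh) = r) /\
  (exists Sh, psd_sqrt Sh Sm /\ \rank (kalman_mx A^T Sh) = r).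

Definition is_Pinfty A Rm Sm P : Prop :=
  pdmx P /\ A *m P + P *m A^T + Rm - P *m Sm *m P = 0.

Definition is_Qinfty A Rm Sm Q : Prop :=
  pdmx Q /\ A^T *m Q + Q *m A - Q *m Rm *m Q + Sm = 0.

End Matrices.

Section Hamiltonian.
Variables (R : realType) (r : nat).
Implicit Types (A Rm Sm Q : 'M[R]_r) (x : 'cV[R]_r) (f : 'cV[R]_r -> R).

Definition basis_vec (i : 'I_r) : 'cV[R]_r := delta_mx i 0.

Definition partial (i : 'I_r) f : 'cV[R]_r -> R := fun x => 'D_(basis_vec i) f x.

Definition grad f x : 'cV[R]_r := \col_i partial i f x.

Definition hessian f x : 'M[R]_r := \matrix_(i, j) partial i (partial j f) x.

(* ['D_v f x] is a total operator (a limit, with a default value); this is the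
   condition under which [grad] and [hessian] are genuine. *)
Definition twice_differentiable f : Prop :=
  (forall x, differentiable f x) /\
  (forall i x, differentiable (partial i f) x).

Definition potential Sm x : R := 2^-1 * quad_form Sm x.

Definition generator A Rm f x : R :=
  ((A *m x)^T *m grad f x) 0 0 + 2^-1 * \tr (Rm *m hessian f x).

Definition hamiltonian A Rm Sm f x : R :=
  - generator A Rm f x + potential Sm x * f x.

Definition h0 Q x : R := expR (- (2^-1 * quad_form Q x)).

End Hamiltonian.

(* R^n with its Borel sigma-algebra (the underlying type is ['cV[R]_n]). *)
Notation borel_cV R n := (g_sigma_algebraType (@open 'cV[R]_n)).

Section Processes.
Local Open Scope ereal_scope.
Context (d : measure_display) (T : measurableType d) (R : realType).
Variable P : probability T R.

(* Processes are indexed by all reals, but only the times t >= 0 matter. *)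
Definition process n := R -> {RV P >-> borel_cV R n}.

Definition sample_path n (X : process n) (w : T) : R -> 'cV[R]_n := fun t => X t w.

Definition ae_continuous_paths n (X : process n) : Prop :=
  {ae P, forall w, {within `[0%R, +oo[, continuous (sample_path X w)}}.

Definition increment n (X : process n) (s t : R) (w : T) : 'cV[R]_n :=
  (sample_path X w t - sample_path X w s)%R.

Definition independent_increments n (X : process n) : Prop :=
  forall (m : nat) (t : nat -> R) (E : nat -> set (borel_cV R n)),
    (0 <= t 0%N)%R -> {homo t : i j / (i <= j)%N >-> (i <= j)%R} ->
    (forall i, measurable (E i)) ->
    P [set w | forall i, (i < m)%N -> E i (increment X (t i) (t i.+1) w)]
    = \prod_(i < m) P [set w | E i (increment X (t i) (t i.+1) w)].

(* X_t - X_s is N(0, (t - s) I_n): its coordinates are independent, with law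
   N(0, t - s); [normal_prob] is parameterized by the standard deviation. *)
Definition gaussian_increments n (X : process n) : Prop :=
  forall (s t : R) (D : 'I_n -> set R),
    (0 <= s)%R -> (s < t)%R -> (forall k, measurable (D k)) ->
    P [set w | forall k, D k (increment X s t w k 0%R)]
    = \prod_(k < n) normal_prob 0%R (Num.sqrt (t - s)) (D k).

Definition brownian_motion n (W : process n) : Prop :=
  [/\ {ae P, forall w, sample_path W w 0%R = 0%R},
      ae_continuous_paths W,
      independent_increments W &
      gaussian_increments W].

(* X solves dX_t = F X_t dt + B dW_t with X_0 = x.  The noise being additive,
   the stochastic integral of the constant matrix B is B W_t (with W_0 = 0),
   and the equation is the pathwise integral equation below. *)
Definition linear_sde_solution r r1 (F : 'M[R]_r) (B : 'M[R]_(r, r1))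
    (W : process r1) (x : 'cV[R]_r) (X : process r) : Prop :=
  ae_continuous_paths X /\
  {ae P, forall w, forall t : R, (0 <= t)%R ->
    sample_path X w t =
      (x
       + (\col_i \int[lebesgue_measure]_(s in `[0, t])
                    ((F *m sample_path X w s) i 0))
       + B *m sample_path W w t)%R}.

(* K_t(f)(x), where x is the starting point of X. *)
Definition FK_propagator r (Sm : 'M[R]_r) (X : process r) (t : R)
    (f : 'cV[R]_r -> \bar R) : \bar R :=
  \int[P]_w (f (sample_path X w t) *
    (expR (- (\int[lebesgue_measure]_(u in `[0, t])
                potential Sm (sample_path X w u)))%R)%:E).

(* K_t(x, E) *)
Definition FK_kernel r (Sm : 'M[R]_r) (X : process r) (t : R)
    (E : set (borel_cV R r)) : \bar R :=
  FK_propagator Sm X t (fun y => (\1_E y)%:E).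

End Processes.

(* Main.v *)
(* The Riccati equation gives the eigenvalue equation by differentiating [h0];
   the two traces agree because [Q] and [- P^-1] solve the same Riccati equation.

   The h-transform identity is a Girsanov formula, obtained without stochastic
   calculus from an exact discrete one.  Cut [0, t] into n + 1 intervals and each
   of these into r1 substeps z |-> D z + u b, with D close to 1, b a column of B
   and u a scalar Gaussian increment of W.  Completing the square in u shows
   that integrating f h0 along a substep is, up to an explicit weight in z,
   h0(z) times integrating f along a tilted substep, again linear in (z, u).  By
   induction along the chain Z of substeps and the tilted chain V,
     E[prod_m weight(Z_m) g(Z_N) h0(Z_N)] = h0(x) E[g(V_N)].
   As n grows, Gronwall's inequality gives Z -> X and V -> X^h path by path (the
   noise is additive), and the Riccati equation turns the product of the weights
   into exp(lambda0 t - int_0^t V(X_s) ds).  The weights are not bounded, so both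
   sides are first multiplied by exp(- eps int |.|^4), which permits dominated
   convergence, and then eps -> 0.  Taking for g bump functions of open boxes, a
   pi-system generating the Borel sets, shows that the law of X^h_t multiplied by
   h0(x) is the law of X_t under the density h0(X_t) exp(lambda0 t - int V(X)). *)
Require Import Defs.
From HB Require Import structures.
From mathcomp Require Import all_boot all_order all_algebra.
From mathcomp Require Import all_classical all_reals all_analysis.
From mathcomp Require Import measurable_realfun ring lra.

Set Implicit Arguments.
Unset Strict Implicit.
Unset Printing Implicit Defensive.

Import Order.TTheory GRing.Theory Num.Theory.
Import numFieldNormedType.Exports.

Local Open Scope classical_set_scope.
Local Open Scope ring_scope.

(** * Riccati equations *)

(** Each substep carries one scalar Gaussian, so only one-dimensional Gaussian integrals have to be
    tilted. The tilt multiplies the variance by [kap ^+ 2] and shifts the mean by a linear function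
    of the state; hence the tilted chain is again a linear recursion driven by the same noise. The
    three factors of a weight have separate limits. The normalisations [1 / kap] multiply up to
    exp(t tr(RQ) / 2), which is where lambda0 comes from. The ratios h0(z) / h0(Dz) and the
    completed squares give the time integrals of z'QAz and of - z'QRQz / 2, whose sum is - V by the
    Riccati equation. Before the limit, z'QAz may be positive and grows quadratically, so a quartic
    factor is what bounds the products uniformly. After the limit, V >= 0 bounds the density by
    exp(lambda0 t), and the factor can be removed. Measurability is a recurring obstacle: the chains
    converge only almost surely, and time integrals along the paths come with no measurability of
    their own. Such functionals are therefore treated as almost everywhere limits of functions of
    finitely many increments. *)

Section QuadraticForms.
Variables (R : realType) (r : nat).
Implicit Types (A P Q M D : 'M[R]_r) (x y : 'cV[R]_r).

Lemma trmx00 (a : 'M[R]_1) : a 0 0 = a^T 0 0.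
Proof. by rewrite mxE. Qed.

Lemma addmx00 (a b : 'M[R]_1) : (a + b) 0 0 = a 0 0 + b 0 0.
Proof. by rewrite mxE. Qed.

Lemma scalemx00 (c : R) (a : 'M[R]_1) : (c *: a) 0 0 = c * a 0 0.
Proof. by rewrite mxE. Qed.

Lemma bilin_sym M x y : M^T = M -> (x^T *m M *m y) 0 0 = (y^T *m M *m x) 0 0.
Proof. by move=> sM; rewrite trmx00 !trmx_mul trmxK sM mulmxA. Qed.

Lemma quad_formD M N x : quad_form (M + N) x = quad_form M x + quad_form N x.
Proof. by rewrite /quad_form mulmxDr mulmxDl mxE. Qed.

Lemma quad_formZ a M x : quad_form (a *: M) x = a * quad_form M x.
Proof. by rewrite /quad_form -scalemxAr -scalemxAl mxE. Qed.

Lemma quad_form_tr M x : quad_form M^T x = quad_form M x.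
Proof. by rewrite /quad_form trmx00 !trmx_mul !trmxK mulmxA. Qed.

Lemma quad_form_mulmx s M (N : 'M[R]_(r, s)) (z : 'cV[R]_s) :
  quad_form M (N *m z) = quad_form (N^T *m M *m N) z.
Proof. by rewrite /quad_form trmx_mul !mulmxA. Qed.

Lemma quad_form_add M x y : M^T = M ->
  quad_form M (x + y) = quad_form M x + 2 * (x^T *m M *m y) 0 0 + quad_form M y.
Proof.
move=> sM; rewrite /quad_form [(x + y)^T]linearD /= !mulmxDl !mulmxDr !addmx00.
by rewrite (bilin_sym y x sM); ring.
Qed.

Lemma pdmx_unit M : pdmx M -> M \in unitmx.
Proof.
(* A row [v] of the kernel satisfies [v M v' = 0], which positivity forbids unless [v = 0]. *)
move=> [sM pM]; rewrite -row_free_unit -kermx_eq0; apply/eqP/row_matrixP => i.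
rewrite row0; apply/eqP; apply: contraT => v0.
have := pM (row i (kermx M))^T; rewrite -trmx0 (inj_eq trmx_inj) => /(_ v0).
by rewrite /quad_form trmxK -row_mul mulmx_ker row0 mul0mx mxE ltxx.
Qed.

Lemma pdmx_inv M : pdmx M -> pdmx (invmx M).
Proof.
move=> pM; have uM := pdmx_unit pM; have [sM qM] := pM.
split=> [|x x0]; first by rewrite trmx_inv sM.
have -> : quad_form (invmx M) x = quad_form M (invmx M *m x).
  by rewrite quad_form_mulmx trmx_inv sM mulVmx// mul1mx.
apply: qM; apply: contra x0 => /eqP Mx; apply/eqP.
by rewrite -(mulKVmx uM x) Mx mulmx0.
Qed.

Lemma pdmxD M N : pdmx M -> pdmx N -> pdmx (M + N).
Proof.
move=> [sM qM] [sN qN]; split=> [|x x0]; first by rewrite linearD /= sM sN.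
by rewrite quad_formD addr_gt0 ?qM ?qN.
Qed.

(* [Q] and [- P^-1] solve the same Riccati equation, so their difference [D]
   satisfies [F' D + D F + D Rm D = 0] with [F = A - Rm Q]. *)
Lemma riccati_trace A Rm Sm P Q : Rm^T = Rm ->
  is_Pinfty A Rm Sm P -> is_Qinfty A Rm Sm Q ->
  \tr (Sm *m P) = \tr (Rm *m Q).
Proof.
move=> sR [pP eP] [pQ eQ].
have uP := pdmx_unit pP; have pU := pdmx_inv pP.
set U := invmx P in pU *.
have [UP PU] : U *m P = 1%:M /\ P *m U = 1%:M by rewrite mulVmx// mulmxV.
(* Multiplying the equation of [P] by [U] on both sides shows that [- U] solves the equation of
   [Q]. *)
have e1 : U *m A + A^T *m U + U *m Rm *m U - Sm = 0.
  have := congr1 (fun M => U *m M *m U) eP.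
  rewrite !(mulmxDr, mulmxDl, mulmxN, mulNmx, mulmx0, mul0mx) !mulmxA UP mul1mx.
  by rewrite -!mulmxA PU !mulmx1 !mulmxA mul1mx.
have e2 : \tr (Sm *m P) = \tr A *+ 2 + \tr (Rm *m U).
  have -> : Sm = U *m A + A^T *m U + U *m Rm *m U.
    by apply/esym/eqP; rewrite -subr_eq0 e1.
  rewrite !mulmxDl !mxtraceD -!mulmxA UP !mulmx1 mxtrace_tr.
  by rewrite mxtrace_mulC -mulmxA PU mulmx1 [\tr (U *m _)]mxtrace_mulC mulr2n.
pose D := Q + U; pose F := A - Rm *m Q.
have uD : D \in unitmx by apply/pdmx_unit/pdmxD.
have e3 : F^T *m D + D *m F + D *m Rm *m D = 0.
  have [sQ _] := pQ.
  rewrite /F /D linearB /= trmx_mul sR sQ.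
  rewrite -(addr0 (0 : 'M[R]_r)) -{1}eQ -[in RHS]e1.
  rewrite !(mulmxDr, mulmxDl, mulmxN, mulNmx) !mulmxA.
  apply/matrixP => i j; rewrite !mxE; ring.
(* [D] is a sum of positive definite matrices, hence invertible. Multiplying [e3] by [invmx D] and
   taking traces gives [2 tr F + tr (Rm D) = 0], since conjugation by [D] preserves the trace. *)
have e4 : \tr A *+ 2 = \tr (Rm *m Q) - \tr (Rm *m U).
  have FD : \tr (invmx D *m (F^T *m D)) = \tr F.
    by rewrite mulmxA mxtrace_mulC mulmxA mulmxV// mul1mx mxtrace_tr.
  have := congr1 (fun M => \tr (invmx D *m M)) e3.
  rewrite 2!mulmxDr !mxtraceD mulmx0 mxtrace0 FD !mulmxA mulVmx// !mul1mx.
  rewrite /F /D (mulmxDr Rm) !mxtraceD -[- (Rm *m Q)]scaleN1r mxtraceZ; lra.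
by rewrite e2 e4 subrK.
Qed.

(** The trace is the sum of the values of [quad_form Q] at the columns of [Rh]. It could vanish only
    for [Rh = 0], but then the Kalman matrix would be zero, against its rank [r > 0]. *)
Lemma riccati_trace_gt0 A Rm Q : (0 < r)%N -> pdmx Q ->
  (exists Rh, psd_sqrt Rh Rm /\ \rank (kalman_mx A Rh) = r) ->
  0 < \tr (Rm *m Q).
Proof.
move=> r0 [sQ qQ] [Rh [[[sRh _] <-]]] rk.
have -> : \tr (Rh *m Rh *m Q) = \sum_i quad_form Q (col i Rh).
  rewrite -mulmxA mxtrace_mulC [LHS]/mxtrace; apply: eq_bigr => i _.
  by rewrite colE quad_form_mulmx sRh /quad_form trmx_delta -rowE -colE [in RHS]mxE [in RHS]mxE.
have Q0 x : 0 <= quad_form Q x.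
  have [->|/qQ/ltW//] := eqVneq x 0.
  by rewrite /quad_form mulmx0 mxE.
have [i Ri|] := pickP (fun i => col i Rh != 0).
  rewrite (bigD1 i)//=; apply: ltr_wpDr; last exact: qQ.
  by apply: sumr_ge0 => j _.
move=> R0; suff Rh0 : Rh = 0.
  have k0 : kalman_mx A Rh = 0.
    by apply/matrixP => i j; rewrite mxE Rh0 mulmx0 !mxE.
  have := mxrank0 R r (\sum_(k < r) r); rewrite -[X in \rank X]k0 rk => r00.
  by rewrite r00 in r0.
apply/matrixP => i j; have /negbFE/eqP/matrixP/(_ i 0) := R0 j.
by rewrite !mxE.
Qed.

End QuadraticForms.

(** * The ground state *)

Section GroundState.
Variables (R : realType) (r : nat).
Implicit Types (A Q M Rm Sm : 'M[R]_r) (x v : 'cV[R]_r).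

Lemma continuous_mulmx_coord m (M : 'M[R]_(m, r)) i :
  continuous (fun y : 'cV[R]_r => (M *m y) i 0).
Proof.
have -> : (fun y : 'cV[R]_r => (M *m y) i 0) =
    \sum_j (M i j *: (fun y : 'cV[R]_r => y j 0 : R)).
  by apply/funext => y; rewrite mxE fct_sumE.
move=> x; apply: differentiable_continuous; apply: differentiable_sum => j.
by apply: differentiableZ; exact: differentiable_coord.
Qed.

Lemma is_diff_mulmx_coord M i x :
  is_diff x (fun y => (M *m y) i 0) (fun v => (M *m v) i 0).
Proof.
have lM : linear (fun y : 'cV[R]_r => (M *m y) i 0).
  by move=> a u w /=; rewrite mulmxDr -scalemxAr !mxE.
pose lMm := GRing.isLinear.Build _ _ _ _ _ lM.
pose f : {linear 'cV[R]_r -> R} := HB.pack (fun y : 'cV[R]_r => (M *m y) i 0) lMm.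
have cf : continuous f by exact: continuous_mulmx_coord.
have -> : (fun y : 'cV[R]_r => (M *m y) i 0) = f by [].
by apply: DiffDef; [exact/linear_differentiable|rewrite diff_lin].
Qed.

Lemma is_diff_fsum n (f df : 'I_n -> 'cV[R]_r -> R) x :
  (forall i, is_diff x (f i) (df i)) ->
  is_diff x (\sum_i f i) (\sum_i df i).
Proof.
by move=> fd; elim/big_ind2 : _ => // [|*]; [exact: is_diff_cst|exact: is_diffD].
Qed.

Lemma is_diff_quad_form M x : M^T = M ->
  is_diff x (quad_form M) (fun v => 2 * (v^T *m M *m x) 0 0).
Proof.
move=> sM.
have -> : quad_form M =
    \sum_i ((fun y : 'cV[R]_r => (1%:M *m y) i 0) * (fun y => (M *m y) i 0)).
  apply/funext => y; rewrite fct_sumE /quad_form -mulmxA mxE.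
  apply: eq_bigr => i _; rewrite -[RHS]/((1%:M *m y) i 0 * (M *m y) i 0).
  by rewrite mul1mx [y^T _ _]mxE.
apply: is_diff_eq; first (apply: is_diff_fsum => i;
  apply: is_diffM; exact: is_diff_mulmx_coord).
apply/funext => v; rewrite fct_sumE mulr_natl mulr2n.
rewrite {1}(bilin_sym _ _ sM) -!mulmxA mxE [X in _ + X]mxE -big_split /=.
apply: eq_bigr => i _.
rewrite -[LHS]/((1%:M *m x) i 0 * (M *m v) i 0 + (M *m x) i 0 * (1%:M *m v) i 0).
by rewrite !mul1mx [x^T _ _]mxE [v^T _ _]mxE [X in _ + X]mulrC.
Qed.

Lemma is_diff_h0 Q x : Q^T = Q ->
  is_diff x (h0 Q) (fun v => - (v^T *m Q *m x) 0 0 * h0 Q x).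
Proof.
move=> sQ.
have -> : h0 Q = expR \o ((- 2^-1) *: quad_form Q).
  by apply/funext => y /=; rewrite /h0 -mulNr.
have qd := is_diff_quad_form x sQ.
have ed : is_diff (((- 2^-1) *: quad_form Q) x) expR
    (fun u => u * expR (- (2^-1 * quad_form Q x))).
  have dE : differentiable expR (((- 2^-1) *: quad_form Q) x).
    exact/derivable1_diffP/derivable_expR.
  apply: DiffDef => //; apply/funext => u.
  rewrite -[u in LHS]mulr1 -[u * 1]/(u *: (1 : R)) linearZ /= -deriveE//.
  by rewrite derive_val /= -mulNr.
have zd := is_diffZ (- 2^-1) qd.
have cd := is_diff_comp zd ed.
apply: is_diff_eq.
apply/funext => v.
rewrite -[LHS]/(- 2^-1 * (2 * (v^T *m Q *m x) 0 0) *
  expR (- (2^-1 * quad_form Q x))).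
rewrite -[RHS]/(- (v^T *m Q *m x) 0 0 * expR (- 2^-1 * quad_form Q x)).
by congr (_ * _); [field|rewrite mulNr].
Qed.

Lemma partial_h0 Q i : Q^T = Q ->
  partial i (h0 Q) = - (fun x => (Q *m x) i 0) * h0 Q.
Proof.
move=> sQ; apply/funext => x; have dh := is_diff_h0 x sQ.
rewrite /partial deriveE ?diff_val//=.
by rewrite /basis_vec trmx_delta -mulmxA -rowE [in LHS]mxE.
Qed.

Lemma is_diff_partial_h0 Q i x : Q^T = Q ->
  is_diff x (partial i (h0 Q))
    (fun v => ((Q *m x) i 0 * (v^T *m Q *m x) 0 0 - (Q *m v) i 0) * h0 Q x).
Proof.
move=> sQ; rewrite partial_h0//; have dh := is_diff_h0 x sQ.
have dq := is_diff_mulmx_coord Q i x.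
apply: is_diff_eq; apply/funext => v.
rewrite -[LHS]/(- (Q *m x) i 0 * (- (v^T *m Q *m x) 0 0 * h0 Q x) +
  h0 Q x * - (Q *m v) i 0); ring.
Qed.

Lemma twice_differentiable_h0 Q : Q^T = Q -> twice_differentiable (h0 Q).
Proof.
move=> sQ; split=> [x|i x].
  by have := is_diff_h0 x sQ; case.
by have := is_diff_partial_h0 i x sQ; case.
Qed.

Lemma grad_h0 Q x : Q^T = Q -> grad (h0 Q) x = - h0 Q x *: (Q *m x).
Proof.
move=> sQ; apply/matrixP => i j; rewrite !mxE partial_h0// ord1.
by rewrite -[LHS]/(- (Q *m x) i 0 * h0 Q x) mxE; ring.
Qed.

Lemma hessian_h0 Q x : Q^T = Q ->
  hessian (h0 Q) x = h0 Q x *: (Q *m x *m (Q *m x)^T - Q).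
Proof.
move=> sQ; apply/matrixP => i j; rewrite mxE /partial.
have dh := is_diff_partial_h0 j x sQ.
rewrite -/(partial j (h0 Q)) deriveE ?diff_val//.
have e1 : ((basis_vec R i)^T *m Q *m x) 0 0 = (Q *m x) i 0.
  by rewrite /basis_vec trmx_delta -mulmxA -rowE [in LHS]mxE.
have e2 : (Q *m basis_vec R i) j 0 = Q i j.
  by rewrite /basis_vec -colE mxE -[in LHS]sQ mxE.
rewrite e1 e2 !mxE big_ord1 !mxE; ring.
Qed.

Lemma hamiltonian_h0 A Rm Sm Q x : Rm^T = Rm -> is_Qinfty A Rm Sm Q ->
  hamiltonian A Rm Sm (h0 Q) x = 2^-1 * \tr (Rm *m Q) * h0 Q x.
Proof.
move=> sR [[sQ _] eQ]; rewrite /hamiltonian /generator grad_h0// hessian_h0//.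
have t1 : \tr (Rm *m (Q *m x *m (Q *m x)^T)) = quad_form (Q *m Rm *m Q) x.
  rewrite mulmxA mxtrace_mulC trmx_mul sQ /quad_form /mxtrace big_ord1.
  by rewrite !mulmxA.
rewrite -scalemxAr mxE -scalemxAr mxtraceZ mulmxBr linearB /= t1.
have t2 : ((A *m x)^T *m (Q *m x)) 0 0 = quad_form (A^T *m Q) x.
  by rewrite trmx_mul /quad_form !mulmxA.
have t3 : quad_form (Q *m A) x = quad_form (A^T *m Q) x.
  by rewrite -[LHS]quad_form_tr trmx_mul sQ.
(* The quadratic terms of the Hamiltonian add up to half the Riccati form at [x], which is zero; the
   constant term of the Hessian leaves the trace. *)
have := congr1 (fun M => quad_form M x) eQ.
rewrite !quad_formD -[- (Q *m _ *m _)]scaleN1r quad_formZ t2 t3.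
have -> : quad_form 0 x = 0 by rewrite /quad_form mulmx0 mul0mx mxE.
rewrite /potential => e.
have -> : quad_form Sm x = quad_form (Q *m Rm *m Q) x - 2 * quad_form (A^T *m Q) x.
  lra.
by field.
Qed.

End GroundState.

(** * Borel sets of vectors *)

Lemma coord_le_norm (R : realType) m n (M : 'M[R]_(m, n)) i j :
  `|M i j| <= `|M|.
Proof.
by rewrite -[leRHS]/(mx_norm M) mx_normrE; apply: (le_bigmax _ _ (i, j)).
Qed.

Section BorelVectors.
Variables (R : realType) (n : nat).

Definition open_box (a b : 'cV[R]_n) : set 'cV[R]_n :=
  [set y | forall i, a i 0 < y i 0 < b i 0].

Definition open_boxes : set (set 'cV[R]_n) :=
  [set U | exists a b, U = open_box a b].

Lemma measurable_open_box a b :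
  measurable (open_box a b : set (borel_cV R n)).
Proof.
have -> : open_box a b = \bigcap_(i in [set: 'I_n])
    ((fun y : 'cV[R]_n => y i 0) @^-1` `]a i 0, b i 0[).
  by apply/seteqP; split => y yab i; have := yab i; rewrite /= ?in_itv//=; apply.
apply: (@fin_bigcap_measurable _ (borel_cV R n)); first exact: finite_finset.
move=> i _; apply: sub_sigma_algebra; apply: open_comp; last exact: interval_open.
by move=> y _; exact: coord_continuous.
Qed.

(** Rational corners keep the union countable, so that open sets lie in the sigma-algebra generated
    by the boxes. *)
Lemma open_bigcup_open_box (U : set 'cV[R]_n) : open U ->
  U = \bigcup_(pq : 'cV[rat]_n * 'cV[rat]_n)
    (let B := open_box (map_mx ratr pq.1) (map_mx ratr pq.2) in
     if `[< B `<=` U >] then B else set0).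
Proof.
move=> oU; apply/seteqP; split=> [y Uy|y [pq _] /=]; last first.
  by case: asboolP => // BU; exact: BU.
have /nbhs_ballP[e /= e0 eU] := open_nbhs_nbhs (conj oU Uy).
have /choice[p pP] : forall i : 'I_n, exists p : rat, ratr p \in `](y i 0 - e), (y i 0)[.
  by move=> i; have [c] := @rat_in_itvoo R (y i 0 - e) (y i 0) (ltac:(lra)); exists c.
have /choice[q qP] : forall i : 'I_n, exists p : rat, ratr p \in `](y i 0), (y i 0 + e)[.
  by move=> i; have [c] := @rat_in_itvoo R (y i 0) (y i 0 + e) (ltac:(lra)); exists c.
exists (\col_i p i, \col_i q i) => //=.
case: asboolP => [_ i|]; first by rewrite !mxE; have := pP i; have := qP i; rewrite !in_itv/=; lra.
case=> z zpq; apply: eU; split=> // i j; rewrite ord1 /ball/= ltr_norml.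
by have := zpq i; have := pP i; have := qP i; rewrite !mxE !in_itv/=; lra.
Qed.

Lemma borel_open_boxes : <<s @open 'cV[R]_n >> = <<s open_boxes >>.
Proof.
apply/seteqP; split; apply: smallest_sub; try exact: smallest_sigma_algebra.
  move=> U /open_bigcup_open_box ->.
  apply: (@countable_bigcupT_measurable _ (g_sigma_algebraType open_boxes)); first exact: countableP.
  move=> pq /=; case: asboolP => _; last exact: measurable0.
  by apply: sub_sigma_algebra; eexists; eexists.
by move=> _ [a [b ->]]; exact: measurable_open_box.
Qed.

Lemma open_boxesI : setI_closed open_boxes.
Proof.
move=> _ _ [a [b ->]] [c [d ->]].
exists (\col_i Num.max (a i 0) (c i 0)), (\col_i Num.min (b i 0) (d i 0)).
apply/seteqP; split=> y /=.
  move=> [yab ycd] i; rewrite !mxE gt_max lt_min.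
  by have /andP[-> ->] := yab i; have /andP[-> ->] := ycd i.
move=> yy; split=> i; have := yy i; rewrite !mxE gt_max lt_min;
by move=> /andP[/andP[? ?] /andP[? ?]]; apply/andP; split.
Qed.

Lemma bigcup_open_boxes :
  \bigcup_k open_box (const_mx (- k%:R)) (const_mx k%:R) = setT.
Proof.
apply/seteqP; split=> // y _; exists (Num.truncn `|y|).+1 => //= i.
rewrite !mxE -ltr_norml.
apply: le_lt_trans (_ : `|y| < _); last exact: truncnS_gt.
exact: coord_le_norm.
Qed.

Section MeasurableVectors.
Context d (T : measurableType d).

Lemma measurable_fun_cV (F : T -> borel_cV R n) :
  (forall i, measurable_fun setT (fun w => (F w : 'cV[R]_n) i 0)) ->
  measurable_fun setT F.
Proof.
move=> mF; apply: (@measurability _ _ T (borel_cV R n) setT F open_boxes); first exact: borel_open_boxes.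
move=> _ [_ [a [b ->]] <-]; rewrite setTI.
have -> : F @^-1` open_box a b = \bigcap_(i in [set: 'I_n])
    ((fun w => (F w : 'cV[R]_n) i 0) @^-1` `]a i 0, b i 0[).
  by apply/seteqP; split => y yab i; have := yab i; rewrite /= ?in_itv//=; apply.
apply: fin_bigcap_measurable; first exact: finite_finset.
by move=> i _; rewrite -[X in measurable X]setTI; exact: mF.
Qed.

End MeasurableVectors.

Lemma continuous_measurable_cV (f : 'cV[R]_n -> R) :
  continuous f -> measurable_fun setT (f : borel_cV R n -> R).
Proof.
move=> /continuousP cf; apply: (measurability _ (measurable_realfun.RGenOpens.measurableE R)).
move=> _ [_ [a [b ->] <-]]; rewrite setTI.
by apply: sub_sigma_algebra; exact/cf/interval_open.
Qed.

Lemma measurable_coord i :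
  measurable_fun setT ((fun y => y i 0) : borel_cV R n -> R).
Proof. by apply: continuous_measurable_cV => y; exact: coord_continuous. Qed.

End BorelVectors.

(** * Markov chains driven by independent noise *)

Section Freezing.
Local Open Scope ereal_scope.
Context d (T : measurableType d) (R : realType) (P : probability T R).
Context dU (U : measurableType dU).
Variables (G : set (set T)) (xi : T -> U) (gam : probability U R).
Hypotheses (Gmeas : G `<=` measurable) (GI : setI_closed G) (GT : G setT).
Hypothesis mxi : measurable_fun setT xi.
Hypothesis indep : forall A D, G A -> measurable D ->
  P (A `&` xi @^-1` D) = P A * gam D.

(** The same space with fewer measurable sets: a function measurable for [T'] depends on the past
    [G] only. *)
Local Notation T' := (g_sigma_algebraType G).

Let mid : measurable_fun setT (fun w : T => w : T').
Proof.
apply: (@measurability _ _ T T' setT _ G) => // _ [A GA <-].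
by rewrite setTI; exact: Gmeas.
Qed.

Let mpair : measurable_fun setT (fun w : T => (w : T', xi w)).
Proof. exact: measurable_fun_pair. Qed.

Let indep_sigma A D : <<s G >> A -> measurable D ->
  P (A `&` xi @^-1` D) = P A * gam D.
Proof.
move=> sA mD.
have mxD : measurable (xi @^-1` D) by rewrite -[X in measurable X]setTI; exact: mxi.
have gfin : gam D = (NngNum (fine_ge0 (measure_ge0 gam D)))%:num%:E.
  by rewrite /= fineK// fin_num_measure.
have -> : P A * gam D = mscale (NngNum (fine_ge0 (measure_ge0 gam D))) P A.
  by rewrite /mscale -gfin muleC.
(* Both sides are finite measures in [A] that agree on the pi-system [G]. Rewriting [gam D] as a
   nonnegative real was needed to see the right-hand side as a scaled measure. *)
rewrite -[LHS]/(mrestr P mxD A).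
apply: (@g_sigma_algebra_measure_unique _ _ _ G _ (fun=> setT)) => //.
- by rewrite bigcup_const.
- move=> B GB; rewrite -[LHS]/(P (B `&` xi @^-1` D)) indep//.
  by rewrite /= /mscale /= muleC fineK// fin_num_measure.
- by move=> k; rewrite -ge0_fin_numE// fin_num_measure.
Qed.

(** By independence the law of [(w, xi w)] on [T' * U] is a product measure, and Tonelli's theorem
    applies: the past is frozen while the new noise is integrated out. *)
Lemma integral_freeze (H : (T' * U)%type -> \bar R) :
  measurable_fun setT H -> (forall z, 0 <= H z) ->
  \int[P]_w H (w, xi w) = \int[P]_w \int[gam]_u H (w, u).
Proof.
move=> mH H0.
pose idX : {RV P >-> T'} :=
  HB.pack (fun w : T => w : T') (isMeasurableFun.Build _ _ _ _ _ mid).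
pose prX : {RV P >-> (T' * U)%type} :=
  HB.pack (fun w : T => (w : T', xi w)) (isMeasurableFun.Build _ _ _ _ _ mpair).
have -> : \int[P]_w H (w, xi w) = \int[distribution P prX]_z H z.
  by rewrite ge0_integral_distribution.
rewrite (eq_measure_integral (distribution P idX \x gam)); last first.
  move=> A mA _; apply/esym/product_measure_unique => // B D mB mD.
rewrite fubini_tonelli1// ge0_integral_distribution//.
  exact: measurable_fun_fubini_tonelli_F.
by move=> w; apply: integral_ge0.
Qed.

End Freezing.

Fixpoint chain (Y U : Type) (phi : nat -> Y * U -> Y) (y0 : Y) (u : nat -> U)
    (m : nat) : Y :=
  if m is k.+1 then phi k (chain phi y0 u k, u k) else y0.

Section MarkovChains.
Local Open Scope ereal_scope.
Context d (T : measurableType d) (R : realType) (P : probability T R).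
Context d' (Y : measurableType d') dU (U : measurableType dU).
Variables (M : nat) (xi : nat -> T -> U) (gam : probability U R).
Hypothesis mxi : forall m, measurable_fun setT (xi m).
Hypothesis iid : forall D : nat -> set U, (forall m, measurable (D m)) ->
  P [set w | forall m, (m < M)%N -> D m (xi m w)] = \prod_(m < M) gam (D m).

(** Cylinder events: a pi-system generating the sigma-algebra of the first [N] noise variables, to
    serve as [G] above. *)
Definition past (N : nat) : set (set T) :=
  [set A | exists D : nat -> set U, (forall m, measurable (D m)) /\
     A = [set w | forall m, (m < N)%N -> D m (xi m w)]].

Let past_measurable N : past N `<=` measurable.
Proof.
move=> _ [D [mD ->]].
have -> : [set w | forall m, (m < N)%N -> D m (xi m w)] =
    \bigcap_(m in `I_N) (xi m @^-1` D m) by [].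
apply: fin_bigcap_measurable; first exact: finite_II.
by move=> m _; rewrite -[X in measurable X]setTI; exact: mxi.
Qed.

Let pastI N : setI_closed (past N).
Proof.
move=> _ _ [D [mD ->]] [E [mE ->]]; exists (fun m => D m `&` E m); split.
  by move=> m; exact: measurableI.
apply/seteqP; split=> [w [Dw Ew] m mN|w DEw]; first by split; auto.
by split=> m /DEw[].
Qed.

Let pastT N : past N setT.
Proof. by exists (fun=> setT); split=> //; apply/seteqP; split. Qed.

Let past_indep N A D : (N < M)%N -> past N A -> measurable D ->
  P (A `&` xi N @^-1` D) = P A * gam D.
Proof.
move=> NM [E [mE ->]] mD.
(* [iid] speaks of all [M] variables at once, so the event is padded with [setT] after index [N].
   Taking [D' = setT] in [PF] then gives the probability of the past event itself. *)
pose F D' m := if (m < N)%N then E m else if m == N then D' else setT.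
have PF D' : measurable D' ->
    P ([set w | forall m, (m < N)%N -> E m (xi m w)] `&` xi N @^-1` D') =
    \prod_(m < N) gam (E m) * gam D'.
  move=> mD'.
  have -> : [set w | forall m, (m < N)%N -> E m (xi m w)] `&` xi N @^-1` D' =
      [set w | forall m, (m < M)%N -> F D' m (xi m w)].
    apply/seteqP; split=> [w [Ew Dw] m mM|w Fw].
      by rewrite /F; case: ifPn => [/Ew//|_]; case: eqP => // ->.
    split=> [m mN|]; first by have := Fw m (ltn_trans mN NM); rewrite /F mN.
    by have := Fw N NM; rewrite /F ltnn eqxx.
  rewrite iid => [|m]; last by rewrite /F; case: ifP => // _; case: ifP.
  rewrite -(big_mkord xpredT (fun m => gam (F D' m))) (big_cat_nat _ (n := N.+1))//=.
  rewrite big_nat_recr//= {2}/F ltnn eqxx.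
  rewrite [X in _ * X]big_nat_cond [X in _ * X]big1 ?mule1.
    congr (_ * _); rewrite big_mkord; apply: eq_bigr => i _.
    by rewrite /F ltn_ord.
  move=> m /andP[/andP[Nm _] _]; rewrite /F ltnNge (ltnW Nm) /= gtn_eqF//.
  exact: probability_setT.
rewrite PF//; congr (_ * _).
by have := PF _ measurableT; rewrite preimage_setT setIT probability_setT mule1.
Qed.

Let measurable_noise N m : (m < N)%N ->
  measurable_fun setT (xi m : g_sigma_algebraType (past N) -> U).
Proof.
move=> mN _ B mB; rewrite setTI; apply: sub_sigma_algebra.
exists (fun k => if k == m then B else setT); split=> [k|]; first by case: ifP.
apply/seteqP; split=> [w Bw k _|w /(_ m mN)]; last by rewrite eqxx.
by case: eqP => // ->.
Qed.

Lemma measurable_chain d1 (S : measurableType d1) (zeta : nat -> S -> U)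
    (phi : nat -> Y * U -> Y) y0 N :
  (forall m, measurable_fun setT (phi m)) ->
  (forall m, (m < N)%N -> measurable_fun setT (zeta m)) ->
  measurable_fun setT (fun w => chain phi y0 (zeta ^~ w) N).
Proof.
move=> mphi; elim: N => [|N IH] mz /=; first exact: measurable_cst.
apply: (measurableT_comp (mphi N)); apply: measurable_fun_pair; last exact: mz.
by apply: IH => m mN; apply: mz; exact: ltnW.
Qed.

Section OneChain.
Variables (phi : nat -> Y * U -> Y) (y0 : Y) (wt : nat -> Y -> R).
Hypothesis mphi : forall m, measurable_fun setT (phi m).
Hypothesis mwt : forall m, measurable_fun setT (wt m).
Hypothesis wt_ge0 : forall m y, (0 <= wt m y)%R.
Let Z w := chain phi y0 (xi ^~ w).

(** The weights up to index [N] involve only the states up to time [N], hence the first [N] noises;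
    the noise of index [N] enters through the last state alone and is integrated out. *)
Lemma integral_chain_last N (F : Y -> \bar R) : (N < M)%N ->
  measurable_fun setT F -> (forall y, 0 <= F y) ->
  \int[P]_w ((\prod_(m < N.+1) wt m (Z w m))%:E * F (Z w N.+1)) =
  \int[P]_w ((\prod_(m < N) wt m (Z w m))%:E *
     ((wt N (Z w N))%:E * \int[gam]_u F (phi N (Z w N, u)))).
Proof.
move=> NM mF F0.
pose S : measurableType _ := g_sigma_algebraType (past N).
have mZ m : (m <= N)%N -> measurable_fun setT (fun w : S => Z w m).
  move=> mN; apply: measurable_chain => // k km.
  by apply: measurable_noise; exact: leq_trans km mN.
pose H (z : S * U) :=
  (\prod_(m < N.+1) wt m (Z z.1 m))%:E * F (phi N (Z z.1 N, z.2)).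
have mZ1 m : (m <= N)%N -> measurable_fun setT (fun z : S * U => Z z.1 m).
  by move=> mN; exact: (measurableT_comp (mZ m mN)).
have mF1 : measurable_fun setT (fun z : S * U => F (phi N (Z z.1 N, z.2))).
  apply: (measurableT_comp mF); apply: (measurableT_comp (mphi N)).
  by apply: measurable_fun_pair => //; exact: mZ1.
have mH : measurable_fun setT H.
  apply: emeasurable_funM => //; apply/measurable_EFinP.
  under eq_fun do rewrite -(big_mkord xpredT (fun m => wt m (Z _ m))).
  apply: measurable_prod => m; rewrite mem_index_iota => /andP[_ mN].
  by apply: (measurableT_comp (mwt m)); exact: mZ1.
have p0 k w : (0 <= \prod_(m < k) wt m (Z w m))%R by apply: prodr_ge0.
have H0 z : 0 <= H z by rewrite mule_ge0// lee_fin.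
rewrite -[LHS]/(\int[P]_w H (w, xi N w)).
rewrite (integral_freeze (@past_measurable N) (@pastI N) (pastT N) (mxi N)
  (fun A D pA mD => past_indep NM pA mD) mH H0).
apply: eq_integral => w _; rewrite /H /=.
rewrite ge0_integralZl//=; last by rewrite lee_fin; exact: (p0 N.+1).
  by rewrite big_ord_recr/= EFinM -muleA.
apply: (measurableT_comp mF); apply: (measurableT_comp (mphi N)).
exact: measurable_pair1.
Qed.

End OneChain.

(** Intertwining of two Markov chains, iterated: the hypothesis in the middle exchanges one weighted
    step of [phi] seen through [h] for one step of [psi]. The induction removes the last step of
    [Z], exchanges it, and restores it as a step of [V]; the two chains are never compared path by
    path. *)
Lemma chain_comparison (phi psi : nat -> Y * U -> Y) (y0 : Y)
    (wt vt : nat -> Y -> R) (h : Y -> R) N (g : Y -> \bar R) :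
  (forall m, measurable_fun setT (phi m)) ->
  (forall m, measurable_fun setT (psi m)) ->
  (forall m, measurable_fun setT (wt m)) ->
  (forall m, measurable_fun setT (vt m)) ->
  (forall m y, (0 <= wt m y)%R) -> (forall m y, (0 <= vt m y)%R) ->
  measurable_fun setT h -> (forall y, (0 <= h y)%R) ->
  (forall m y (f : Y -> \bar R), measurable_fun setT f -> (forall y, 0 <= f y) ->
    (wt m y)%:E * \int[gam]_u (f (phi m (y, u)) * (h (phi m (y, u)))%:E) =
    (vt m y)%:E * (\int[gam]_u f (psi m (y, u))) * (h y)%:E) ->
  measurable_fun setT g -> (forall y, 0 <= g y) -> (N <= M)%N ->
  let Z w := chain phi y0 (xi ^~ w) in
  let V w := chain psi y0 (xi ^~ w) in
  \int[P]_w ((\prod_(m < N) wt m (Z w m))%:E * (g (Z w N) * (h (Z w N))%:E)) =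
  (h y0)%:E * \int[P]_w ((\prod_(m < N) vt m (V w m))%:E * g (V w N)).
Proof.
move=> mphi mpsi mwt mvt wt0 vt0 mh h0 step + + + Z V.
elim: N g => [|N IH] g mg g0 NM.
  under eq_integral do rewrite big_ord0 mul1e.
  under [in RHS]eq_integral do rewrite big_ord0 mul1e.
  have icst (a : \bar R) : \int[P]_w a = a.
    rewrite -[LHS]/(\int[P]_w cst a w) integral_cst//.
    by rewrite -[RHS]mule1; congr (_ * _); exact: probability_setT.
  rewrite -[LHS]/(\int[P]_w (g y0 * (h y0)%:E)).
  by rewrite -[X in _ = _ * X]/(\int[P]_w (g y0)) !icst muleC.
have mpair1 (k : nat -> Y * U -> Y) y : (forall m, measurable_fun setT (k m)) ->
    measurable_fun setT (fun u => g (k N (y, u))).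
  move=> mk; apply: (measurableT_comp mg); apply: (measurableT_comp (mk N)).
  exact: measurable_pair1.
rewrite (integral_chain_last y0 mphi mwt wt0 NM (F := fun y => g y * (h y)%:E)).
(* The test function for the induction hypothesis: the last tilted step applied to [g], with its
   weight. *)
- pose g' y := (vt N y)%:E * \int[gam]_u g (psi N (y, u)).
  under eq_integral do rewrite step//.
  rewrite (integral_chain_last y0 mpsi mvt vt0 NM mg g0) -(IH g')//.
  + apply: emeasurable_funM; first exact/measurable_EFinP.
    apply: (@measurable_fun_fubini_tonelli_F _ _ Y U R gam
      (fun z => g (psi N z))) => //.
    exact: (measurableT_comp mg).
  + by move=> y; rewrite mule_ge0 ?lee_fin//; apply: integral_ge0.
  + exact: ltnW.
- by apply: emeasurable_funM => //; exact/measurable_EFinP.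
- by move=> y; rewrite mule_ge0 ?lee_fin.
Qed.

End MarkovChains.

(** * Gaussian integrals and the discrete Girsanov formula *)

Section Density.
Local Open Scope ereal_scope.
Context d (T : measurableType d) (R : realType).
Variables (mu nu : {measure set T -> \bar R}) (p : T -> R).
Hypotheses (mp : measurable_fun setT p) (p0 : forall x, (0 <= p x)%R).
Hypothesis nuE : forall A, measurable A -> nu A = \int[mu]_(x in A) (p x)%:E.

Import HBNNSimple.

(** Monotone approximation by simple functions reduces the claim to indicators, where it is
    [nuE]. *)
Lemma ge0_integral_density (f : T -> \bar R) :
  measurable_fun setT f -> (forall x, 0 <= f x) ->
  \int[nu]_x f x = \int[mu]_x (f x * (p x)%:E).
Proof.
move=> mf f0; pose f_ := nnsfun_approx measurableT mf.
have f_cvg x : (f_ n x)%:E @[n --> \oo] --> f x.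
  by apply: cvg_nnsfun_approx.
transitivity (limn (fun n => \int[nu]_x (f_ n x)%:E)).
  rewrite -monotone_convergence//.
  - by apply: eq_integral => x _; apply/esym/cvg_lim => //; exact: f_cvg.
  - by move=> n; exact/measurable_EFinP.
  - by move=> n x _; rewrite lee_fin.
  - by move=> x _ m n mn; rewrite lee_fin; exact/lefP/nd_nnsfun_approx.
transitivity (limn (fun n => \int[mu]_x ((f_ n x)%:E * (p x)%:E))); last first.
  rewrite -monotone_convergence//.
  - apply: eq_integral => x _; apply/cvg_lim => //.
    by apply: cvgeZr => //; exact: f_cvg.
  - by move=> n; apply: emeasurable_funM; exact/measurable_EFinP.
  - by move=> n x _; rewrite mule_ge0 ?lee_fin.
  - move=> x _ m n mn; apply: lee_wpmul2r; rewrite lee_fin//.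
    exact/lefP/nd_nnsfun_approx.
congr (limn _); apply/funext => n.
have ind0 k x : 0 <= (k * \1_(f_ n @^-1` [set k]) x)%:E.
  rewrite lee_fin indicE; have [xk|_] := boolP (x \in _); last by rewrite mulr0.
  by move: xk => /set_mem /= <-; rewrite mulr1.
transitivity (\sum_(k \in range (f_ n)) \int[nu]_x (k * \1_(f_ n @^-1` [set k]) x)%:E).
  under eq_integral do rewrite fimfunE -fsumEFin//.
  rewrite ge0_integral_fsum//.
  by move=> y; exact/measurable_EFinP/measurable_funM.
transitivity (\sum_(k \in range (f_ n))
    \int[mu]_x ((k * \1_(f_ n @^-1` [set k]) x)%:E * (p x)%:E)); last first.
  rewrite -ge0_integral_fsum//.
  - apply: eq_integral => x _; rewrite -ge0_mule_fsuml//.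
    by rewrite fsumEFin// -fimfunE.
  - move=> k; apply: emeasurable_funM; last exact/measurable_EFinP.
    exact/measurable_EFinP/measurable_funM.
  - by move=> k x _; apply: mule_ge0; [exact: ind0|rewrite lee_fin].
apply: eq_fsbigr => k _; rewrite integralZl_indic_nnsfun// integral_indic//= setIT nuE//.
(* The approximants are nonnegative, so a negative value has an empty preimage and contributes
   nothing. *)
have [k0|k0] := ltP k 0%R.
  by rewrite preimage_nnfun0// integral_set0 mule0 integral0_eq// => x _; rewrite indicE in_set0 mulr0 mul0e.
under [RHS]eq_integral do rewrite EFinM -muleA.
rewrite ge0_integralZl//=.
- congr (_ * _); rewrite integral_mkcond; apply: eq_integral => x _.
  by rewrite patchE indicE; case: ifP; rewrite ?mul1e ?mul0e.
- apply: emeasurable_funM; exact/measurable_EFinP.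
- by move=> x _; rewrite mule_ge0 ?lee_fin.
Qed.

End Density.

Section Gaussian.
Variable R : realType.
Local Notation mu := (@lebesgue_measure R).

Let affine (a c : R) : measurableTypeR R -> measurableTypeR R :=
  fun v => a * v + c.

Let measurable_affine a c : measurable_fun setT (affine a c).
Proof. by apply: measurable_funD => //; exact: measurable_funM. Qed.

Let scaled_affine (a c : R) (a0 : 0 < a) :
    {measure set (measurableTypeR R) -> \bar R} :=
  mscale (NngNum (ltW a0))
    (measure_function_pushforward__canonical__measure_function_Measure
       mu (measurable_affine a c)).

(** The right-hand side is a measure in [A], so uniqueness of Lebesgue measure reduces the claim to
    half-open intervals. *)
Lemma lebesgue_measure_affine (a c : R) (A : set (measurableTypeR R)) :
  0 < a -> measurable A ->
  (mu A = a%:E * mu ((fun v => a * v + c)%R @^-1` A))%E.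
Proof.
move=> a0 mA; rewrite -[RHS]/(scaled_affine c a0 A).
apply: lebesgue_measure_unique => // _ [[x y]] _ <-.
rewrite -[RHS]/(a%:E * mu (affine a c @^-1` `]x, y]))%E.
have -> : affine a c @^-1` `]x, y] = `](x - c) / a, (y - c) / a]%classic.
  apply/seteqP; split => v; rewrite /affine /= !in_itv/=;
  by rewrite ltr_pdivrMr// ler_pdivlMr// ltrBlDr lerBrDr mulrC.
rewrite !lebesgue_measure_itv/= !lte_fin ltr_pM2r ?invr_gt0// ltrD2r.
case: ifPn => // _; rewrite -?EFinB -?EFinM ?mule0//; congr EFin; last by rewrite mulr0.
by field; rewrite gt_eqF.
Qed.

Lemma ge0_integral_affine (a c : R) (f : R -> \bar R) : 0 < a ->
  measurable_fun setT f -> (forall x, (0 <= f x)%E) ->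
  (\int[mu]_x f x = a%:E * \int[mu]_v f (a * v + c)%R)%E.
Proof.
move=> a0 mf f0.
rewrite (eq_measure_integral (scaled_affine c a0)); last first.
  by move=> A mA _; exact: lebesgue_measure_affine.
by rewrite ge0_integral_mscale// ge0_integral_pushforward.
Qed.

Lemma ge0_integral_normal (s : R) (f : R -> \bar R) :
  measurable_fun setT f -> (forall x, (0 <= f x)%E) ->
  (\int[normal_prob 0 s]_x f x = \int[mu]_x (f x * (normal_pdf 0 s x)%:E))%E.
Proof.
move=> mf f0; apply: ge0_integral_density => //; first exact: measurable_normal_pdf.
exact: normal_pdf_ge0.
Qed.

(* Completing the square: tilting N(0, s^2) by a Gaussian factor gives another
   Gaussian, with variance [k^2 s^2] and mean [- k^2 s^2 beta]. *)
Lemma normal_tilt (s q k beta : R) (f : R -> \bar R) :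
  0 < s -> 0 < k -> k ^+ 2 * (1 + q * s ^+ 2) = 1 ->
  measurable_fun setT f -> (forall x, (0 <= f x)%E) ->
  (\int[normal_prob 0 s]_u (f u * (expR (- (u * beta) - 2^-1 * q * u ^+ 2))%R%:E) =
   (k * expR (2^-1 * s ^+ 2 * k ^+ 2 * beta ^+ 2))%R%:E *
     \int[normal_prob 0 s]_v f (k * v - s ^+ 2 * k ^+ 2 * beta)%R)%E.
Proof.
move=> s0 k0 kE mf f0; set m := (- (s ^+ 2 * k ^+ 2 * beta))%R.
have sN0 : s != 0 by rewrite gt_eqF.
have kN0 : k != 0 by rewrite gt_eqF.
have me : measurable_fun setT (fun u : R => expR (- (u * beta) - 2^-1 * q * u ^+ 2)).
  apply: measurableT_comp => //; apply: measurable_funB.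
    by apply: measurableT_comp => //; exact: measurable_funM.
  by apply: measurable_funM => //; exact: exprn_measurable.
have mn : measurable_fun setT (EFin \o normal_pdf (0 : R) s).
  by apply/measurable_EFinP; exact: measurable_normal_pdf.
have mfe : measurable_fun setT
    (fun u => (f u * (expR (- (u * beta) - 2^-1 * q * u ^+ 2))%R%:E)%E).
  by apply: emeasurable_funM => //; exact/measurable_EFinP.
have mfa : measurable_fun setT (fun v => f (k * v - s ^+ 2 * k ^+ 2 * beta)).
  by apply: measurableT_comp => //; exact: (measurable_affine k m).
rewrite !ge0_integral_normal//; last by move=> x; rewrite mule_ge0 ?lee_fin.
(* The substitution [u = k v + m] turns the tilted density back into that of N(0, s^2), up to the
   stated constant. *)
rewrite (@ge0_integral_affine k m)//; first last.
- by move=> x; rewrite !mule_ge0 ?lee_fin// normal_pdf_ge0.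
- exact: emeasurable_funM.
rewrite EFinM -muleA; congr (_ * _)%E.
rewrite -ge0_integralZl//; first last.
- by move=> x _; rewrite mule_ge0 ?lee_fin// normal_pdf_ge0.
- exact: emeasurable_funM.
apply: eq_integral => v _; rewrite [RHS]muleCA -[LHS]muleA; congr (_ * _)%E.
rewrite -!EFinM; congr EFin; rewrite !normal_pdfE// /normal_fun !subr0.
rewrite mulrCA [RHS]mulrCA; congr (_ * _); rewrite -!expRD; congr expR.
(* Eliminating [q] by means of [kE] leaves an identity of rational functions for the exponents. *)
have qE : q = (k ^- 2 - 1) / s ^+ 2.
  have -> : k ^- 2 = 1 + q * s ^+ 2.
    by rewrite -[RHS](mulKf (expf_neq0 2 kN0)) kE mulr1.
  by field.
by rewrite qE /m; field; rewrite sN0 kN0.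
Qed.

End Gaussian.

Section RealContinuity.
Variables (R : realType) (T : topologicalType).
Implicit Types f g : T -> R.

Lemma continuous_mul f g : continuous f -> continuous g ->
  continuous (fun x => f x * g x).
Proof. by move=> cf cg x; apply: cvgM; [exact: cf|exact: cg]. Qed.

Lemma continuous_opp f : continuous f -> continuous (fun x => - f x).
Proof. by move=> cf x; apply: (@cvgN _ R^o); exact: cf. Qed.

Lemma continuous_add f g : continuous f -> continuous g ->
  continuous (fun x => f x + g x).
Proof. by move=> cf cg x; apply: (@cvgD _ R^o); [exact: cf|exact: cg]. Qed.

Lemma continuous_sub f g : continuous f -> continuous g ->
  continuous (fun x => f x - g x).
Proof. by move=> cf cg x; apply: (@cvgB _ R^o); [exact: cf|exact: cg]. Qed.

Lemma continuous_inv f : (forall x, f x != 0) -> continuous f ->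
  continuous (fun x => (f x)^-1).
Proof. by move=> f0 cf x; apply: cvgV; [exact: f0|exact: cf]. Qed.

Lemma continuous_exp f : continuous f -> continuous (fun x => expR (f x)).
Proof.
by move=> cf x; exact: (@continuous_comp _ _ _ f expR x (cf x) (@continuous_expR R _)).
Qed.

Lemma continuous_cst (a : R) : continuous (fun _ : T => a).
Proof. by move=> x; exact: cvg_cst. Qed.

Lemma continuous_pow f n : continuous f -> continuous (fun x => f x ^+ n).
Proof.
by move=> cf x; exact: (@continuous_comp _ _ _ f (fun u => u ^+ n) x (cf x) (@exprn_continuous R n _)).
Qed.

End RealContinuity.

(** * Tilting of linear Gaussian chains *)

Section LinearChains.
Variables (R : realType) (r : nat).

(** Both chains have this form. The factor [k m] is 1 for the original chain; in the tilted one it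
    rescales the same noise to the variance obtained by completing the square. *)
Definition affine_step (L : nat -> 'M[R]_r) (k : nat -> R) (b : nat -> 'cV[R]_r)
    (m : nat) (zu : 'cV[R]_r * R) : 'cV[R]_r :=
  L m *m zu.1 + (k m * zu.2) *: b m.

Lemma measurable_affine_step L k b m :
  measurable_fun setT (affine_step L k b m : borel_cV R r * measurableTypeR R -> borel_cV R r).
Proof.
apply: measurable_fun_cV => i.
under eq_fun do rewrite mxE [X in _ + X]mxE.
apply: measurable_funD; last first.
  apply: measurable_funM; last exact: measurable_cst.
  by apply: measurable_funM; [exact: measurable_cst|exact: measurable_snd].
apply: (@measurableT_comp _ _ _ _ _ _ (fun z : borel_cV R r => (L m *m z) i 0)) => //.
by apply: continuous_measurable_cV; exact: continuous_mulmx_coord.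
Qed.

Lemma continuous_quad_form (M : 'M[R]_r) : continuous (quad_form M).
Proof.
have -> : quad_form M = \sum_i ((fun y : 'cV[R]_r => y i 0) *
    (fun y : 'cV[R]_r => (M *m y) i 0)).
  apply/funext => y; rewrite fct_sumE /quad_form -mulmxA mxE.
  by apply: eq_bigr => i _; rewrite mxE.
move=> x; apply: differentiable_continuous; apply: differentiable_sum => i.
apply: differentiableM; first exact: differentiable_coord.
by have [] := is_diff_mulmx_coord M i x.
Qed.

Lemma h0_gt0 (Q : 'M[R]_r) x : 0 < h0 Q x.
Proof. exact: expR_gt0. Qed.

Lemma continuous_h0 (Q : 'M[R]_r) : continuous (h0 Q).
Proof.
apply: continuous_exp; apply: continuous_opp.
by apply: continuous_mul; [exact: continuous_cst|exact: continuous_quad_form].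
Qed.

Variables (Q : 'M[R]_r) (s : R) (D : nat -> 'M[R]_r) (b : nat -> 'cV[R]_r).
Variables (k : nat -> R) (cut : 'cV[R]_r -> R).
Hypotheses (sQ : Q^T = Q) (s0 : 0 < s) (k0 : forall m, 0 < k m).
Hypothesis kE : forall m, k m ^+ 2 * (1 + quad_form Q (b m) * s ^+ 2) = 1.
Hypotheses (ccut : continuous cut) (cut0 : forall z, 0 <= cut z).

Let beta m (z : 'cV[R]_r) : R := ((b m)^T *m Q *m (D m *m z)) 0 0.

(* The constant and the matrix that [normal_tilt] yields when [h0 Q] is
   integrated along the step [z |-> D m z + u b m]. *)
Definition tilt_weight m (z : 'cV[R]_r) : R :=
  cut z * (h0 Q z / (h0 Q (D m *m z) * (k m * expR (2^-1 * s ^+ 2 * k m ^+ 2 *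
    ((b m)^T *m Q *m (D m *m z)) 0 0 ^+ 2)))).

Definition tilt_mx m : 'M[R]_r :=
  D m - (s ^+ 2 * k m ^+ 2) *: (b m *m ((b m)^T *m Q *m D m)).

Let tilt_weight_ge0 m z : 0 <= tilt_weight m z.
Proof.
apply: mulr_ge0; first exact: cut0.
apply/ltW/divr_gt0; first exact: h0_gt0.
apply: mulr_gt0; first exact: h0_gt0.
by apply: mulr_gt0; [exact: k0|exact: expR_gt0].
Qed.

Let beta_cont m : continuous (beta m).
Proof.
have -> : beta m = fun z => ((b m)^T *m Q *m D m *m z) 0 0.
  by apply/funext => z; rewrite /beta !mulmxA.
exact: continuous_mulmx_coord.
Qed.

Lemma continuous_tilt_weight m : continuous (tilt_weight m).
Proof.
apply: continuous_mul => //; apply: continuous_mul; first exact: continuous_h0.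
apply: continuous_inv => [z|].
  apply/lt0r_neq0/mulr_gt0; first exact: h0_gt0.
  by apply: mulr_gt0; [exact: k0|exact: expR_gt0].
apply: continuous_mul.
  apply: continuous_exp; apply: continuous_opp; apply: continuous_mul.
    exact: continuous_cst.
  have -> : (fun z => quad_form Q (D m *m z)) = quad_form ((D m)^T *m Q *m D m).
    by apply/funext => y; rewrite quad_form_mulmx.
  exact: continuous_quad_form.
apply: continuous_mul; first exact: continuous_cst.
apply: continuous_exp; apply: continuous_mul; first exact: continuous_cst.
by apply: continuous_pow; exact: beta_cont.
Qed.

Let h0_step m z u : h0 Q (affine_step D (fun=> 1%R) b m (z, u)) =
  h0 Q (D m *m z) * expR (- (u * beta m z) - 2^-1 * quad_form Q (b m) * u ^+ 2).
Proof.
rewrite /h0 -expRD; congr expR; rewrite /affine_step /= mul1r quad_form_add//.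
rewrite -scalemxAr scalemx00 (bilin_sym _ _ sQ) -/(beta m z).
have -> : quad_form Q (u *: b m) = u ^+ 2 * quad_form Q (b m).
  rewrite /quad_form -scalemxAr [(u *: b m)^T]linearZ /= -!scalemxAl.
  by rewrite !scalerA scalemx00.
by field.
Qed.

(** The one-step exchange required by [chain_comparison], with [h0 Q] as the function [h] and [cut]
    as the weight of the tilted chain. *)
Lemma tilt_step m (z : 'cV[R]_r) (f : borel_cV R r -> \bar R) :
  measurable_fun setT f -> (forall y, (0 <= f y)%E) ->
  ((tilt_weight m z)%:E * \int[normal_prob 0 s]_u
     (f (affine_step D (fun=> 1%R) b m (z, u)) *
       (h0 Q (affine_step D (fun=> 1%R) b m (z, u)))%:E) =
   (cut z)%:E * (\int[normal_prob 0 s]_u f (affine_step tilt_mx k b m (z, u))) *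
     (h0 Q z)%:E)%E.
Proof.
move=> mf f0.
have mstep L c : measurable_fun setT (fun u : R => f (affine_step L c b m (z, u))).
  apply: (measurableT_comp mf).
  apply: (@measurableT_comp _ _ _ _ _ _ (affine_step L c b m : borel_cV R r * measurableTypeR R -> borel_cV R r)).
    exact: measurable_affine_step.
  exact: measurable_pair1.
under eq_integral do rewrite h0_step mulrC EFinM muleA.
have mtilt : measurable_fun setT (fun u : R =>
    (f (affine_step D (fun=> 1%R) b m (z, u)) *
    (expR (- (u * beta m z) - 2^-1 * quad_form Q (b m) * u ^+ 2))%:E)%E).
  apply: emeasurable_funM => //; apply/measurable_EFinP.
  apply: measurableT_comp => //; apply: measurable_funB.
    by apply: measurableT_comp => //; exact: measurable_funM.
  by apply: measurable_funM => //; exact: exprn_measurable.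
rewrite ge0_integralZr//; last 2 first.
- by move=> u _; rewrite mule_ge0 ?lee_fin ?expR_ge0.
- by rewrite lee_fin ltW ?h0_gt0.
rewrite (normal_tilt (k := k m))//.
(* The shift of the mean is linear in [z], so it is absorbed into the matrix of the step. *)
have -> : (\int[normal_prob 0 s]_v f (affine_step D (fun=> 1%R) b m
      (z, (k m * v - s ^+ 2 * k m ^+ 2 * beta m z)%R)) =
    \int[normal_prob 0 s]_u f (affine_step tilt_mx k b m (z, u)))%E.
  apply: eq_integral => v _; congr f; rewrite /affine_step /tilt_mx /= mul1r.
  rewrite mulmxBl -addrA; congr (_ + _); rewrite scalerBl addrC; congr (_ + _).
  congr (- _); rewrite -scalemxAl -scalerA; congr (_ *: _).
  apply/matrixP => i j; rewrite ord1 -!mulmxA mxE [in RHS]mxE big_ord1.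
  by rewrite mulrC /beta -!mulmxA.
set I := (\int[_]_u f _)%E.
rewrite (muleAC _ I) [RHS]muleAC muleA -!EFinM; congr (_%:E * _)%E.
rewrite /tilt_weight -/(beta m z).
have := h0_gt0 Q (D m *m z); have := k0 m.
have := expR_gt0 (2^-1 * s ^+ 2 * k m ^+ 2 * beta m z ^+ 2).
set e := expR _; set h := h0 Q (D m *m z) => e0 km0 hm0.
by field; rewrite !gt_eqF.
Qed.

Context d (T : measurableType d) (P : probability T R).
Variables (M : nat) (xi : nat -> T -> R).
Hypothesis mxi : forall m, measurable_fun setT (xi m).
Hypothesis iid : forall E : nat -> set R, (forall m, measurable (E m)) ->
  P [set w | forall m, (m < M)%N -> E m (xi m w)] =
  (\prod_(m < M) normal_prob 0 s (E m))%E.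

Lemma discrete_girsanov (x : 'cV[R]_r) (g : 'cV[R]_r -> R) :
  continuous g -> (forall z, 0 <= g z) ->
  let Z w := chain (affine_step D (fun=> 1%R) b) x (xi ^~ w) in
  let V w := chain (affine_step tilt_mx k b) x (xi ^~ w) in
  (\int[P]_w ((\prod_(m < M) tilt_weight m (Z w m)) *
      (g (Z w M) * h0 Q (Z w M)))%:E =
   (h0 Q x)%:E * \int[P]_w ((\prod_(m < M) cut (V w m)) * g (V w M))%:E)%E.
Proof.
move=> cg g0 Z V.
have := @chain_comparison _ T R P _ (borel_cV R r) _ (measurableTypeR R) M xi (normal_prob 0 s) mxi iid
  (affine_step D (fun=> 1%R) b) (affine_step tilt_mx k b) x tilt_weight
  (fun=> cut) (h0 Q) M (fun z => (g z)%:E).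
apply=> //.
- by move=> m; exact: measurable_affine_step.
- by move=> m; exact: measurable_affine_step.
- by move=> m; apply: continuous_measurable_cV; exact: continuous_tilt_weight.
- by move=> m; exact: continuous_measurable_cV.
- by apply: continuous_measurable_cV; exact: continuous_h0.
- by move=> y; rewrite ltW// h0_gt0.
- by move=> m y f mf f0; exact: tilt_step.
- by apply/measurable_EFinP; exact: continuous_measurable_cV.
Qed.

End LinearChains.

(** * Convergence of the Euler schemes *)

Section Analysis.
Variable R : realType.
Local Notation mu := (@lebesgue_measure R).

(** Only [y] is confined to [K]. This matters because the points of the schemes lie near the range
    of the limit path without belonging to it. *)
Lemma compact_unif (V1 V2 : normedModType R) (K : set V1) (f : V1 -> V2) (e : R) :
  compact K -> continuous f -> 0 < e ->
  exists2 rho, 0 < rho &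
    forall y z, K y -> `|z - y| <= rho -> `|f z - f y| <= e.
Proof.
move=> /compact_near_coveringP cK cf e0.
have [rho] : exists rho, 0 < rho /\
    (forall y, K y -> forall z, `|z - y| <= rho -> `|f z - f y| <= e).
  near (0 : R)^'+ => rho; exists rho; split => //.
  near: rho.
  apply: (cK R (0 : R)^'+ (fun rho y => forall z, `|z - y| <= rho ->
    `|f z - f y| <= e)) => y0 Ky0.
  have /cvgrPdist_lt/(_ (e / 2)) := cf y0.
  rewrite divr_gt0// => /(_ isT)/nbhs_ballP[eta /= eta0 fe].
  have eta20 : 0 < eta / 2 by rewrite divr_gt0.
  (* Half the radius is spent on the distance from [y0] to [y] and half on the distance from [y] to
     [z]. *)
  exists (ball y0 (eta / 2), [set rho | rho < eta / 2]).
    by split => /=; [exact: nbhsx_ballx|exact: nbhs_right_lt].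
  move=> [y rho] [/= yy0 rhoe] z zy.
  have Hy : `|f y0 - f y| < e / 2.
    by apply: fe; apply: le_ball yy0; rewrite ler_pdivrMr// ler_peMr// ?ler1n// ltW.
  have Hz : `|f y0 - f z| < e / 2.
    apply: fe; rewrite -ball_normE /ball_ /=; move: yy0.
    rewrite -ball_normE /ball_ /= => yy0.
    apply: le_lt_trans (ler_distD y _ _) _.
    by rewrite (splitr eta) ltrD// distrC (le_lt_trans zy).
  apply: le_trans (ler_distD (f y0) _ _) _.
  by rewrite (splitr e) lerD// ltW// distrC.
by case=> rho0 H; exists rho => // y z Ky; exact: H.
Unshelve. all: by end_near. Qed.

Lemma compact_norm_bound (V : normedModType R) (K : set V) : compact K ->
  exists2 C, 0 < C & forall y, K y -> `|y| <= C.
Proof.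
move=> /compact_bounded [M [Mr MK]]; exists (`|M| + 1); first by rewrite ltr_wpDl.
by move=> y Ky; apply: MK => //; rewrite (le_lt_trans (ler_norm M))// ltrDl.
Qed.

Lemma gronwall_sum (a : nat -> R) (eta c : R) N : 0 <= eta -> 0 <= c ->
  (forall m, (m <= N)%N -> a m <= eta + c * \sum_(i < m) a i) ->
  forall m, (m <= N)%N -> a m <= eta * expR (c * m%:R).
Proof.
move=> eta0 c0 aN.
(* The discrete Gronwall argument: the bounding expression, rather than [a m], is the quantity that
   grows by at most [1 + c] at each step. *)
have S m : (m <= N)%N -> eta + c * \sum_(i < m) a i <= eta * (1 + c) ^+ m.
  elim: m => [|m IH] mN; first by rewrite big_ord0 mulr0 addr0 expr0 mulr1.
  rewrite big_ord_recr /= exprSr.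
  have := IH (ltnW mN); have := aN m (ltnW mN); set s := \sum_(_ < _) _ => h1 h2.
  have : c * a m <= c * (eta * (1 + c) ^+ m) by rewrite ler_wpM2l//; lra.
  by rewrite mulrDr mulrA; nra.
move=> m mN; apply: le_trans (aN m mN) _; apply: le_trans (S m mN) _.
rewrite ler_wpM2l// mulrC expRM_natl lerXn2r ?nnegrE ?expR_ge0 ?addr_ge0//.
exact: expR_ge1Dx.
Qed.

Lemma integrable_continuous (f : R -> R) a b : continuous f ->
  mu.-integrable `[a, b] (EFin \o f).
Proof.
move=> cf; apply: continuous_compact_integrable; first exact: segment_compact.
exact: continuous_subspaceT.
Qed.

Lemma Rintegral_increment (f : R -> R) (a b c e : R) : continuous f ->
  0 <= a -> a <= b -> (forall s, a <= s <= b -> `|f s - c| <= e) ->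
  `|\int[mu]_(s in `[0, b]) f s - \int[mu]_(s in `[0, a]) f s - (b - a) * c|
    <= (b - a) * e.
Proof.
move=> cf a0 ab fe.
have iab : mu.-integrable `]a, b] (EFin \o f).
  apply: integrableS (integrable_continuous a b cf) => //.
  by apply: subset_itvr; rewrite bnd_simp.
have muab : mu `]a, b]%classic = (b - a)%:E.
  rewrite lebesgue_measure_itv /= lte_fin; case: ltP => // ba.
  by rewrite (le_anti (introT andP (conj ab ba))) subrr.
have icst d : mu.-integrable `]a, b] (EFin \o cst d).
  apply: integrableS (integrable_continuous a b (@cst_continuous _ _ d)) => //.
  by apply: subset_itvr; rewrite bnd_simp.
have Rcst d : \int[mu]_(s in `]a, b]) cst d s = (b - a) * d.
  rewrite [LHS]Rintegral_cst// mulrC; congr (_ * _).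
  exact: (congr1 fine muab).
rewrite Rintegral_itvB//; last exact: integrable_continuous.
rewrite -(Rcst c) -RintegralB// -(Rcst e).
have iB : mu.-integrable `]a, b] (EFin \o (fun s => f s - cst c s)).
  apply: (@integrableS _ _ _ mu `[a, b]) => //.
    by apply: subset_itvr; rewrite bnd_simp.
  apply: integrable_continuous => s.
  by apply: (@cvgB _ R^o); [exact: cf|exact: cvg_cst].
apply: le_trans (le_normr_Rintegral _ _) _ => //.
apply: le_Rintegral => //; first exact: integrable_norm.
by move=> s; rewrite /= in_itv /= => /andP[as_ sb]; apply: fe; rewrite (ltW as_).
Qed.

Lemma riemann_sum_bound (f : R -> R) (dt e : R) N : continuous f -> 0 <= dt ->
  (forall k s, (k < N)%N -> k%:R * dt <= s <= k.+1%:R * dt ->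
     `|f s - f (k%:R * dt)| <= e) ->
  `|\int[mu]_(s in `[0, N%:R * dt]) f s - \sum_(k < N) dt * f (k%:R * dt)|
    <= N%:R * dt * e.
Proof.
move=> cf dt0; elim: N => [|N IH] fe.
  by rewrite !mul0r big_ord0 subr0 set_itv1 Rintegral_set1 normr0.
have := IH (fun k s kN => fe k s (leqW kN)).
have := @Rintegral_increment f (N%:R * dt) (N.+1%:R * dt) (f (N%:R * dt)) e cf.
have -> : N.+1%:R * dt - N%:R * dt = dt by rewrite -mulrBl -natrB// subSnn mul1r.
move=> /(_ (mulr_ge0 (ler0n _ _) dt0)).
rewrite ler_wpM2r ?ler_nat// => /(_ isT (fun s => fe N s (ltnSn N))).
set I1 := Rintegral _ _ _; set I0 := Rintegral _ _ _.
rewrite big_ord_recr /=; set S := \sum_(_ < _) _ => h1 h2.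
have -> : I1 - (S + dt * f (N%:R * dt)) =
    (I1 - I0 - dt * f (N%:R * dt)) + (I0 - S) by ring.
apply: le_trans (ler_normD _ _) _; rewrite -natr1 mulrDl mul1r mulrDl; lra.
Qed.

(** The norm is the largest absolute value of an entry, hence the factor [n]. *)
Lemma norm_mulmx m n p (M : 'M[R]_(m, n)) (N : 'M[R]_(n, p)) :
  `|M *m N| <= n%:R * `|M| * `|N|.
Proof.
rewrite -[leLHS]/(mx_norm _) mx_normrE; apply/bigmax_leP; split=> [|[i j] _].
  by rewrite !mulr_ge0.
rewrite mxE; apply: le_trans (ler_norm_sum _ _ _) _ => /=.
have -> : n%:R * `|M| * `|N| = \sum_(l < n) `|M| * `|N|.
  by rewrite sumr_const card_ord -mulrA mulr_natl.
by apply: ler_sum => l _; rewrite normrM ler_pM// coord_le_norm.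
Qed.

Lemma norm_col_le m n (M : 'M[R]_(m, n)) j : `|col j M| <= `|M|.
Proof.
rewrite -[leLHS]/(mx_norm _) mx_normrE; apply/bigmax_leP; split=> [//|[i l] _].
by rewrite /= mxE coord_le_norm.
Qed.

Lemma norm_cV_le n (v : 'cV[R]_n) (c : R) : 0 <= c ->
  (forall i, `|v i 0| <= c) -> `|v| <= c.
Proof.
move=> c0 vc; rewrite -[leLHS]/(mx_norm _) mx_normrE; apply/bigmax_leP.
by split=> // -[i j] _ /=; rewrite ord1.
Qed.

Lemma Rintegral_ord_sum q (f : 'I_q -> R -> R) a b :
  (forall i, continuous (f i)) ->
  \int[mu]_(s in `[a, b]) (\sum_i f i s) = \sum_i \int[mu]_(s in `[a, b]) f i s.
Proof.
elim: q f => [|q IH] f cf.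
  rewrite big_ord0 -[LHS]/(\int[mu]_(s in `[a, b]) _) .
  under eq_Rintegral do rewrite big_ord0.
  by rewrite Rintegral_cst// mul0r.
under eq_Rintegral do rewrite big_ord_recr /=.
rewrite RintegralD//; last 2 first.
- apply: integrable_continuous => s.
  have -> : (fun s => \sum_(i < q) f (widen_ord (leqnSn q) i) s) =
      \sum_(i < q) f (widen_ord (leqnSn q) i) by apply/funext => u; rewrite fct_sumE.
  elim/big_ind : _ => [|g h cg ch|i _]; [exact: cvg_cst| |exact: cf].
  by apply: (@cvgD _ R^o).
- exact: integrable_continuous.
by rewrite IH// big_ord_recr.
Qed.

Lemma cvg_comp_continuous (f : R -> R) (u : nat -> R) (a : R) :
  continuous f -> u n @[n --> \oo] --> a -> f (u n) @[n --> \oo] --> f a.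
Proof. by move=> cf ua; exact: (cvg_comp u f ua (cf a)). Qed.

Lemma cvg_ord_sum q (f : 'I_q -> nat -> R) (l : 'I_q -> R) :
  (forall i, f i n @[n --> \oo] --> l i) ->
  (\sum_i f i n) @[n --> \oo] --> \sum_i l i.
Proof.
elim: q f l => [|q IH] f l fl.
  by rewrite big_ord0; under eq_fun do rewrite big_ord0; exact: cvg_cst.
rewrite big_ord_recr; under eq_fun do rewrite big_ord_recr /=.
by apply: (@cvgD _ R^o); [apply: IH => i; exact: fl|exact: fl].
Qed.

End Analysis.

(** A flat index stands for a grid interval [a] and a substep [l]; the remainder [j] allows for an
    unfinished last interval. *)
Lemma big_blocks (V : Type) (idx : V) (op : Monoid.law idx) (q k j : nat)
    (f : nat -> V) :
  \big[op/idx]_(i < k * q + j) f i =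
  op (\big[op/idx]_(a < k) \big[op/idx]_(l < q) f (a * q + l)%N)
     (\big[op/idx]_(l < j) f (k * q + l)%N).
Proof.
elim: k j => [|k IH] j; first by rewrite big_ord0 Monoid.mul1m mul0n.
rewrite big_ord_recr /= mulSnr -addnA IH -Monoid.mulmA; congr (op _ _).
rewrite big_split_ord /=; congr (op _ _).
by apply: eq_bigr => l _; rewrite addnA.
Qed.

Lemma sum_blocks (V : nmodType) (q k j : nat) (f : nat -> V) :
  \sum_(i < k * q + j) f i =
  \sum_(a < k) \sum_(l < q) f (a * q + l)%N + \sum_(l < j) f (k * q + l)%N.
Proof. exact: big_blocks. Qed.

Lemma sum_divmod (V : nmodType) (q m : nat) (f : nat -> V) :
  \sum_(i < m) f i =
  \sum_(a < m %/ q) \sum_(l < q) f (a * q + l)%N +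
  \sum_(l < m %% q) f (m %/ q * q + l)%N.
Proof.
by rewrite -sum_blocks -!(big_mkord xpredT f) -divn_eq.
Qed.

Lemma mulmx_col_sum (R : realType) m n (M : 'M[R]_(m, n)) (v : 'cV[R]_n) :
  M *m v = \sum_l v l 0 *: col l M.
Proof.
apply/matrixP => i j; rewrite ord1 mxE summxE; apply: eq_bigr => l _.
by rewrite !mxE mulrC.
Qed.

Lemma addr_regroup (V : zmodType) (a b c d : V) :
  a + b + c - d = - (d - a) + b + c.
Proof. by rewrite opprB -!addrA [- d + _]addrC -!addrA. Qed.

(** * Pathwise convergence of the substep scheme *)

Section EulerScheme.
Variables (R : realType) (r p : nat) (t : R) (F : 'M[R]_r) (B : 'M[R]_(r, p.+1)).
Variables (x : 'cV[R]_r) (om : R -> 'cV[R]_p.+1) (X : R -> 'cV[R]_r).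
Local Notation mu := (@lebesgue_measure R).
Local Notation q := p.+1.
Hypotheses (t0 : 0 < t) (com : continuous om) (cX : continuous X) (om0 : om 0 = 0).
Hypothesis XE : forall s, 0 <= s ->
  X s = x + (\col_i \int[mu]_(u in `[0, s]) ((F *m X u) i 0)) + B *m om s.
Variables (L : nat -> 'I_q -> 'M[R]_r) (k : nat -> 'I_q -> R) (C : R).
Hypothesis L_bounded : forall n j, `|L n j| <= C.

(* Substep [m] of the [n]-th scheme adds coordinate [m %% q] of the increment of
   [om] over the grid interval number [m %/ q]. *)
Definition time_step (n : nat) : R := t / n.+1%:R.

Definition grid (n a : nat) : R := a%:R * time_step n.

Definition coord_index (m : nat) : 'I_q := inord (m %% q).

Definition noise (om' : R -> 'cV[R]_q) (n m : nat) : R :=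
  (om' (grid n (m %/ q).+1) - om' (grid n (m %/ q))) (coord_index m) 0.

(** One scheme covers both chains: the original one with constant drift parts and [k = 1], the
    tilted one with drifts and noise factors that depend on [n]. The limit sees only the sum of
    [L n j] over [j]. *)
Definition euler (n m : nat) : 'cV[R]_r :=
  chain (affine_step (fun i => 1%:M + time_step n *: L n (coord_index i))
           (fun i => k n (coord_index i)) (fun i => col (coord_index i) B))
    x (noise om n) m.

Let dt_gt0 n : 0 < time_step n. Proof. by rewrite divr_gt0. Qed.

Let dt_ge0 n : 0 <= time_step n. Proof. exact: ltW. Qed.

Lemma grid_last n : grid n n.+1 = t.
Proof. by rewrite /grid /time_step mulrC divfK. Qed.

Lemma grid_in n a : (a <= n.+1)%N -> 0 <= grid n a <= t.
Proof.
move=> an; rewrite mulr_ge0//= -(grid_last n) /grid ler_wpM2r//.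
by rewrite ler_nat.
Qed.

Lemma coord_index_block a (l : 'I_q) : coord_index (a * q + l) = l.
Proof. by rewrite /coord_index modnMDl modn_small// inord_val. Qed.

Lemma div_block a (l : 'I_q) : ((a * q + l) %/ q)%N = a.
Proof. by rewrite divnMDl// divn_small// addn0. Qed.

Lemma euler_sum n m : euler n m = x + \sum_(i < m)
  (time_step n *: (L n (coord_index i) *m euler n i) +
   (k n (coord_index i) * noise om n i) *: col (coord_index i) B).
Proof.
elim: m => [|m IH]; first by rewrite big_ord0 addr0.
rewrite big_ord_recr /= addrA -IH {1}/euler /= -/(euler n m) /affine_step /=.
by rewrite mulmxDl mul1mx -scalemxAl -addrA.
Qed.

Section Residual.
Variables (n : nat) (e K : R).
Hypotheses (e0 : 0 <= e) (K0 : 0 <= K) (C0 : 0 <= C).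
Hypothesis XK : forall s, 0 <= s <= t -> `|X s| <= K.
Hypothesis omK : forall s, 0 <= s <= t -> `|om s| <= K.
Hypothesis Xe : forall s s', 0 <= s <= t -> 0 <= s' <= t ->
  `|s' - s| <= time_step n -> `|X s' - X s| <= e.
Hypothesis ome : forall s s', 0 <= s <= t -> 0 <= s' <= t ->
  `|s' - s| <= time_step n -> `|om s' - om s| <= e.
Hypothesis k2 : forall l, `|k n l| <= 2.

Let grid_step a : grid n a.+1 - grid n a = time_step n.
Proof. by rewrite /grid -mulrBl -natrB// subSnn mul1r. Qed.

(** By [XE] this is the drift integral of [F *m X] up to [s], for [s >= 0]. *)
Let I s := X s - x - B *m om s.

Let riemann a : (a <= n.+1)%N ->
  `|I (grid n a) - \sum_(i < a) time_step n *: (F *m X (grid n i))|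
    <= t * (r%:R * `|F| * e).
Proof.
move=> an; have /andP[ga0 gat] := grid_in an.
have nFe0 : 0 <= r%:R * `|F| * e by rewrite !mulr_ge0.
apply: norm_cV_le => [|i]; first by rewrite mulr_ge0// ltW.
have -> : (I (grid n a) - \sum_(i < a) time_step n *: (F *m X (grid n i))) i 0 =
    \int[mu]_(u in `[0, grid n a]) ((F *m X u) i 0) -
    \sum_(b < a) time_step n * ((F *m X (grid n b)) i 0).
  rewrite /I XE// mxE [X in _ + X]mxE summxE; congr (_ - _).
    rewrite [x + _]addrC addrAC addrK.
    by rewrite -addrA addrN addr0 mxE.
  by apply: eq_bigr => b _; rewrite mxE.
apply: le_trans (@riemann_sum_bound _ (fun u => (F *m X u) i 0) _
  (r%:R * `|F| * e) a _ (dt_ge0 n) _) _.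
- move=> s; apply: (@continuous_comp _ _ _ X (fun y => (F *m y) i 0)); first exact: cX.
  exact: continuous_mulmx_coord.
- move=> b s ba /andP[bs sb].
  have -> : (F *m X s) i 0 - (F *m X (b%:R * time_step n)) i 0 =
      (F *m (X s - X (grid n b))) i 0.
    by rewrite mulmxBr; apply/esym; rewrite mxE [X in _ + X]mxE.
  apply: le_trans (coord_le_norm _ _ _) _; apply: le_trans (norm_mulmx _ _) _.
  rewrite ler_wpM2l ?mulr_ge0//.
  have bn : (b < n.+1)%N by exact: leq_trans ba an.
  have := grid_step b; have /andP[? ?] := grid_in (ltnW bn); have /andP[? ?] := grid_in bn.
  rewrite -/(grid n b) in bs; rewrite -/(grid n b.+1) in sb => gs.
  apply: Xe; [exact: grid_in (ltnW bn)|lra|rewrite ger0_norm; lra].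
- by rewrite -/(grid n a) ler_wpM2r.
Qed.

Let dL := `|\sum_l L n l - F|.

Let norm_sum_const (V : normedModType R) j (f : 'I_j -> V) c :
  (forall i, `|f i| <= c) -> `|\sum_(i < j) f i| <= j%:R * c.
Proof.
move=> fc; apply: le_trans (ler_norm_sum _ _ _) _.
have -> : j%:R * c = \sum_(i < j) c by rewrite sumr_const card_ord mulr_natl.
by apply: ler_sum => i _; exact: fc.
Qed.

Let block_le m : (m <= n.+1 * q)%N -> (m %/ q <= n.+1)%N.
Proof. by move=> mN; rewrite -(mulnK n.+1 (ltn0Sn p)) leq_div2r. Qed.

(** The three terms are the Riemann sum error, the replacement of the summed drift parts by [F], and
    the unfinished block of fewer than [q] substeps. *)
Let drift_residual m : (m <= n.+1 * q)%N ->
  `|\sum_(i < m) time_step n *: (L n (coord_index i) *m X (grid n (i %/ q)))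
    - I (grid n (m %/ q))|
  <= t * (r%:R * `|F| * e) + t * (r%:R * dL * K) +
     q%:R * (time_step n * (r%:R * C * K)).
Proof.
move=> mN; have an := block_le mN; set a := (m %/ q)%N in an *.
have jq : (m %% q < q)%N by rewrite ltn_mod.
have XgK b : (b <= n.+1)%N -> `|X (grid n b)| <= K.
  by move=> bn; apply: XK; exact: grid_in.
rewrite (sum_divmod q m (fun i =>
  time_step n *: (L n (coord_index i) *m X (grid n (i %/ q))))) -/a.
rewrite (eq_bigr (fun b : 'I_a => time_step n *: (F *m X (grid n b)) +
    time_step n *: ((\sum_l L n l - F) *m X (grid n b)))); last first.
  move=> b _; rewrite -scalerDr -mulmxDl addrC subrK mulmx_suml scaler_sumr.
  by apply: eq_bigr => l _; rewrite coord_index_block div_block.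
rewrite big_split /=.
set S0 := \sum_(_ < a) _; set S3 := \sum_(_ < a) _; set S2 := \sum_(_ < _) _.
have -> : S0 + S3 + S2 - I (grid n a) = - (I (grid n a) - S0) + S3 + S2.
  exact: addr_regroup.
apply: le_trans (ler_normD _ _) _; apply: lerD.
  apply: le_trans (ler_normD _ _) _; apply: lerD.
    by rewrite normrN; exact: riemann.
  apply: le_trans (@norm_sum_const _ _ _ (time_step n * (r%:R * dL * K)) _) _.
    move=> b; rewrite normrZ ger0_norm// ler_wpM2l//.
    apply: le_trans (norm_mulmx _ _) _; rewrite ler_wpM2l ?mulr_ge0//.
    by apply: XgK; exact: leq_trans (ltnW (ltn_ord b)) an.
  rewrite mulrA -/(grid n a) ler_wpM2r ?mulr_ge0 ?normr_ge0//.
  by have /andP[] := grid_in an.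
apply: le_trans (@norm_sum_const _ _ _ (time_step n * (r%:R * C * K)) _) _.
  move=> l; have lq : (l < q)%N := ltn_trans (ltn_ord l) jq.
  rewrite (coord_index_block a (Ordinal lq)) (div_block a (Ordinal lq)).
  rewrite normrZ ger0_norm// ler_wpM2l//.
  apply: le_trans (norm_mulmx _ _) _.
  by apply: ler_pM; rewrite ?mulr_ge0//; [rewrite ler_wpM2l|exact: XgK].
by apply: ler_wpM2r; [rewrite !mulr_ge0// ltW|rewrite ler_nat ltnW].
Qed.

(** Over complete blocks the increments of each coordinate telescope to its value at the last grid
    point, as [om 0 = 0]. What remains comes from [k n l - 1] and from the unfinished block. *)
Let noise_residual m : (m <= n.+1 * q)%N ->
  `|\sum_(i < m) (k n (coord_index i) * noise om n i) *: col (coord_index i) B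
    - B *m om (grid n (m %/ q))|
  <= (\sum_l `|k n l - 1|) * (K * `|B|) + q%:R * (2 * e * `|B|).
Proof.
move=> mN; have an := block_le mN; set a := (m %/ q)%N in an *.
have jq : (m %% q < q)%N by rewrite ltn_mod.
rewrite (sum_divmod q m (fun i =>
  (k n (coord_index i) * noise om n i) *: col (coord_index i) B)) -/a.
rewrite exchange_big /=.
rewrite (eq_bigr (fun l => (k n l * om (grid n a) l 0) *: col l B)); last first.
  move=> l _.
  rewrite (eq_bigr (fun i : 'I_a => (k n l * (om (grid n i.+1) l 0 -
      om (grid n i) l 0)) *: col l B)); last first.
    by move=> i _; rewrite /noise coord_index_block div_block !mxE.
  rewrite -scaler_suml -mulr_sumr.
  rewrite -(big_mkord xpredT (fun i => om (grid n i.+1) l 0 - om (grid n i) l 0)).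
  by rewrite telescope_sumr// /grid mul0r om0 mxE subr0.
rewrite mulmx_col_sum addrAC -sumrB.
apply: le_trans (ler_normD _ _) _; apply: lerD.
  rewrite mulr_suml; apply: le_trans (ler_norm_sum _ _ _) _.
  apply: ler_sum => l _; rewrite -scalerBl -{2}[om _ _ _]mul1r -mulrBl.
  rewrite normrZ normrM -mulrA ler_wpM2l// ler_pM// ?norm_col_le//.
  apply: le_trans (coord_le_norm _ _ _) _.
  by apply: omK; exact: grid_in.
apply: le_trans (@norm_sum_const _ _ _ (2 * e * `|B|) _) _.
  move=> l; have lq : (l < q)%N := ltn_trans (ltn_ord l) jq.
  (* A substep of the unfinished block can exist only if interval [a] is within the grid, so its
     right end is still at most [t]. *)
  have a1n : (a.+1 <= n.+1)%N.
    rewrite -(ltn_pmul2r (ltn0Sn p)).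
    apply: leq_trans mN; rewrite [X in (_ < X)%N](divn_eq m q) -/a.
    by rewrite -[X in (X < _)%N]addn0 ltn_add2l (leq_ltn_trans (leq0n l)).
  rewrite /noise (coord_index_block a (Ordinal lq)) (div_block a (Ordinal lq)).
  rewrite normrZ normrM ler_pM ?mulr_ge0// ?norm_col_le//.
  rewrite ler_pM//; apply: le_trans (coord_le_norm _ _ _) _.
  apply: ome; [exact: grid_in (ltnW a1n)|exact: grid_in|].
  by rewrite grid_step ger0_norm.
by apply: ler_wpM2r; [rewrite !mulr_ge0|rewrite ler_nat ltnW].
Qed.

Definition euler_error : R :=
  t * (r%:R * `|F| * e) + t * (r%:R * `|\sum_l L n l - F| * K) +
  q%:R * (time_step n * (r%:R * C * K)) +
  ((\sum_l `|k n l - 1|) * (K * `|B|) + q%:R * (2 * e * `|B|)).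

Lemma euler_error_bound m : (m <= n.+1 * q)%N ->
  `|euler n m - X (grid n (m %/ q))| <=
  euler_error * expR (r%:R * C * t * q%:R).
Proof.
move=> mN.
have E0 : 0 <= euler_error.
  by rewrite /euler_error !addr_ge0// !mulr_ge0// ?sumr_ge0// ltW.
have c0 : 0 <= time_step n * (r%:R * C) by rewrite !mulr_ge0// ltW.
apply: le_trans (@gronwall_sum _ (fun m => `|euler n m - X (grid n (m %/ q))|)
  euler_error _ (n.+1 * q)%N E0 c0 _ m mN) _; last first.
  rewrite ler_wpM2l// ler_expR.
  have -> : r%:R * C * t * q%:R = time_step n * (r%:R * C) * (n.+1 * q)%N%:R.
    by rewrite natrM -[in LHS](grid_last n) /grid; ring.
  by rewrite ler_wpM2l// ler_nat.
move=> {mN}m mN.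
(* The scheme evaluated along the true path gives the two residuals; the last sum feeds the errors
   of earlier substeps to [gronwall_sum]. *)
have -> : euler n m - X (grid n (m %/ q)) =
    (\sum_(i < m) time_step n *: (L n (coord_index i) *m X (grid n (i %/ q)))
      - I (grid n (m %/ q))) +
    (\sum_(i < m) (k n (coord_index i) * noise om n i) *: col (coord_index i) B
      - B *m om (grid n (m %/ q))) +
    \sum_(i < m) time_step n *: (L n (coord_index i) *m
      (euler n i - X (grid n (i %/ q)))).
  rewrite euler_sum big_split /=.
  under [X in _ = _ + X]eq_bigr do rewrite mulmxBr scalerBr.
  rewrite sumrB /I; apply/matrixP => i j; rewrite !mxE; ring.
apply: le_trans (ler_normD _ _) _; apply: lerD.
  apply: le_trans (ler_normD _ _) _.
  exact: lerD (drift_residual mN) (noise_residual mN).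
apply: le_trans (ler_norm_sum _ _ _) _; rewrite mulr_sumr; apply: ler_sum => i _.
rewrite normrZ ger0_norm// -mulrA ler_wpM2l//.
apply: le_trans (norm_mulmx _ _) _.
by rewrite ler_wpM2r// ler_wpM2l.
Qed.

End Residual.

(** Convergence is uniform over the substeps, each compared with the path at the left end of its
    grid interval. *)
Definition tracks (Z : nat -> nat -> 'cV[R]_r) : Prop :=
  forall eta, 0 < eta -> \forall n \near \oo, forall m, (m <= n.+1 * q)%N ->
    `|Z n m - X (grid n (m %/ q))| <= eta.

Lemma cvg_time_step : time_step n @[n --> \oo] --> 0.
Proof.
rewrite -(mulr0 t); apply: cvgM; first exact: cvg_cst.
exact: cvg_harmonic.
Qed.

Hypothesis LF : (\sum_j L n j) @[n --> \oo] --> F.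
Hypothesis k1 : forall j, k n j @[n --> \oo] --> (1 : R).

Lemma euler_tracks : tracks euler.
Proof.
move=> eta eta0.
have C0 : 0 <= C := le_trans (normr_ge0 _) (L_bounded 0%N ord0).
have cpt : compact `[0, t] := @segment_compact R 0 t.
have [K1 K10 XK1] := compact_norm_bound
  (continuous_compact (continuous_subspaceT cX) cpt).
have [K2 K20 omK2] := compact_norm_bound
  (continuous_compact (continuous_subspaceT com) cpt).
pose K := K1 + K2.
have K0 : 0 <= K by rewrite ltW// addr_gt0.
have XK s : 0 <= s <= t -> `|X s| <= K.
  move=> st; apply: (@le_trans _ _ K1); last by rewrite lerDl ltW.
  by apply: XK1; exists s => //=; rewrite in_itv.
have omK s : 0 <= s <= t -> `|om s| <= K.
  move=> st; apply: (@le_trans _ _ K2); last by rewrite lerDr ltW.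
  by apply: omK2; exists s => //=; rewrite in_itv.
pose G := expR (r%:R * C * t * q%:R); have G0 : 0 < G by exact: expR_gt0.
(* Up to the added 1, which makes it positive, [D] is the coefficient of the modulus [e] in
   [euler_error]. With [G] the Gronwall factor, [e] then uses up half of [eta / G]. *)
pose D := t * (r%:R * `|F|) + q%:R * (2 * `|B|) + 1.
have D0 : 0 < D by rewrite ltr_wpDl// addr_ge0// !mulr_ge0// ltW.
pose e := eta / G / 2 / D.
have e0 : 0 < e by rewrite !divr_gt0.
have [rho1 rho10 Xe] := compact_unif cpt cX e0.
have [rho2 rho20 ome] := compact_unif cpt com e0.
(* The terms of [euler_error] without [e]; these tend to 0 by themselves and take the other half. *)
pose rest n := t * (r%:R * `|\sum_l L n l - F| * K) +
  q%:R * (time_step n * (r%:R * C * K)) + (\sum_l `|k n l - 1|) * (K * `|B|).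
have rest0 : rest n @[n --> \oo] --> 0.
  have -> : (0 : R) = t * (r%:R * 0 * K) + q%:R * (0 * (r%:R * C * K)) +
    (\sum_(l < q) 0) * (K * `|B|) by rewrite big1//; ring.
  apply: cvgD; first apply: cvgD.
  - apply: cvgM; first exact: cvg_cst.
    apply: cvgM; last exact: cvg_cst.
    apply: cvgM; first exact: cvg_cst.
    apply/cvgrPdist_le => d d0; move/cvgrPdist_le : LF => /(_ _ d0).
    by apply: filterS => n; rewrite sub0r normrN normr_id distrC.
  - apply: cvgM; first exact: cvg_cst.
    by apply: cvgM; [exact: cvg_time_step|exact: cvg_cst].
  - apply: cvgM; last exact: cvg_cst.
    apply: cvg_ord_sum => l; apply/cvgrPdist_le => d d0.
    move/cvgrPdist_le : (k1 l) => /(_ _ d0).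
    by apply: filterS => n; rewrite sub0r normrN normr_id distrC.
have dt_near rho : 0 < rho -> \forall n \near \oo, time_step n <= rho.
  move=> rho0; have /cvgrPdist_le/(_ _ rho0) := cvg_time_step.
  by apply: filterS => n; rewrite sub0r normrN ger0_norm.
have k_near : \forall n \near \oo, forall l, `|k n l| <= 2.
  apply: filter_forall => l.
  have /cvgrPdist_le/(_ _ ltr01) := k1 l; apply: filterS => n h.
  by rewrite -[k n l](subrK 1) (le_trans (ler_normD _ _))// normr1 lerD2r distrC.
have rest_near : \forall n \near \oo, rest n <= eta / G / 2.
  have /cvgrPdist_le/(_ (eta / G / 2)) := rest0.
  rewrite !divr_gt0// => /(_ isT); apply: filterS => n.
  by rewrite sub0r normrN; apply: le_trans; exact: ler_norm.
near=> n => m mN.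
apply: le_trans (@euler_error_bound n e K (ltW e0) K0 C0 XK omK _ _ _ m mN) _.
- move=> s s' s0t s'0t ss'; apply: Xe; first by rewrite /= in_itv.
  by apply: le_trans ss' _; near: n; exact: dt_near.
- move=> s s' s0t s'0t ss'; apply: ome; first by rewrite /= in_itv.
  by apply: le_trans ss' _; near: n; exact: dt_near.
- by near: n; exact: k_near.
rewrite -/G -ler_pdivlMr//.
have rn : rest n <= eta / G / 2 by near: n.
have -> : euler_error n e K = (D - 1) * e + rest n.
  by rewrite /euler_error /rest /D; ring.
have De : D * e = eta / G / 2 by rewrite /e mulrC divfK// gt_eqF.
have -> : eta / G = eta / G / 2 + eta / G / 2 by exact: splitr.
by apply: lerD => //; rewrite -De ler_pM2r// lerBlDr lerDl.
Unshelve. all: by end_near. Qed.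

Section AlongTracking.
Variable Z : nat -> nat -> 'cV[R]_r.
Hypothesis ZX : tracks Z.

Lemma tracks_last (f : 'cV[R]_r -> R) : continuous f ->
  f (Z n (n.+1 * q)%N) @[n --> \oo] --> f (X t).
Proof.
move=> cf; apply/cvgrPdist_le => e e0.
have cK : compact [set X t] by exact: compact_set1.
have [rho rho0 fe] := compact_unif cK cf e0.
have := ZX rho0; apply: filterS => n Zn; rewrite distrC; apply: fe => //.
by have := Zn _ (leqnn _); rewrite mulnK// grid_last.
Qed.

(** Sampling every block at the same substep [j] gives a Riemann sum of [f] along the path, up to an
    error controlled by uniform continuity of [f] near the compact range of the path. *)
Lemma tracks_riemann (f : 'cV[R]_r -> R) (j : 'I_q) : continuous f ->
  (\sum_(a < n.+1) time_step n * f (Z n (a * q + j)%N)) @[n --> \oo] -->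
  \int[mu]_(s in `[0, t]) f (X s).
Proof.
move=> cf; apply/cvgrPdist_le => e e0.
have cpt : compact `[0, t] := @segment_compact R 0 t.
pose e1 := e / 2 / t.
have e10 : 0 < e1 by rewrite !divr_gt0.
have cfX : continuous (f \o X) by move=> s; apply: continuous_comp; [exact: cX|exact: cf].
have [rho1 rho10 fXe] := compact_unif cpt cfX e10.
have [rho2 rho20 fe] := compact_unif
  (continuous_compact (continuous_subspaceT cX) cpt) cf e10.
have dt_near : \forall n \near \oo, time_step n <= rho1.
  have /cvgrPdist_le/(_ _ rho10) := cvg_time_step.
  by apply: filterS => n; rewrite sub0r normrN ger0_norm.
apply: filterS2 dt_near (ZX rho20) => n dtn Zn.
have te : t * e1 = e / 2 by rewrite mulrC /e1 divfK// gt_eqF.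
have gstep a : grid n a.+1 = grid n a + time_step n.
  by rewrite /grid -natr1 mulrDl mul1r.
have rb : `|\int[mu]_(s in `[0, t]) f (X s) -
    \sum_(a < n.+1) time_step n * f (X (grid n a))| <= e / 2.
  rewrite -te -{1 2}(grid_last n).
  apply: (@riemann_sum_bound _ (f \o X)) => // a s an /andP[as_ sa].
  have /andP[ga gt] := grid_in (ltnW an).
  apply: fXe; first by rewrite /= in_itv /= ga.
  rewrite -/(grid n a) in as_; rewrite -/(grid n a.+1) gstep in sa.
  rewrite -/(grid n a) ger0_norm ?subr_ge0//.
  by apply: le_trans dtn; rewrite lerBlDl.
rewrite [e]splitr; apply: le_trans (ler_distD
  (\sum_(a < n.+1) time_step n * f (X (grid n a))) _ _) _.
apply: lerD => //; rewrite -sumrB.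
apply: le_trans (ler_norm_sum _ _ _) _.
have -> : e / 2 = \sum_(a < n.+1) time_step n * e1.
  have gl : n.+1%:R * time_step n = t := grid_last n.
  rewrite sumr_const card_ord -te -mulr_natl mulrA; congr (_ * _).
  by rewrite gl.
apply: ler_sum => a _; rewrite -mulrBr normrM ger0_norm// ler_wpM2l// distrC.
apply: fe; first by exists (grid n a) => //=; rewrite in_itv /= grid_in// ltnW.
have := Zn (a * q + j)%N; rewrite div_block; apply.
have : (a * q + j < a.+1 * q)%N by rewrite mulSnr ltn_add2l.
by move=> /ltnW/leq_trans; apply; rewrite leq_mul2r ltn_ord orbT.
Qed.

End AlongTracking.

End EulerScheme.

(** * Convergence of the weights *)

Section Weights.
Variables (R : realType) (r p : nat) (t : R) (A Rm Sm Q : 'M[R]_r).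
Variables (B : 'M[R]_(r, p.+1)) (eps : R).
Local Notation mu := (@lebesgue_measure R).
Local Notation q := p.+1.
Local Notation ts := (time_step t).
Local Notation idx := (coord_index p).
Hypotheses (t0 : 0 < t) (eps0 : 0 < eps) (sQ : Q^T = Q).
Hypothesis Q0 : forall z, 0 <= quad_form Q z.
Hypothesis BB : B *m B^T = Rm.
Hypothesis riccati : A^T *m Q + Q *m A - Q *m Rm *m Q + Sm = 0.

(* Each of the [q] substeps carries the fraction 1/q of the drift. *)
Definition drift_part : 'M[R]_r := q%:R^-1 *: A.
Local Notation Aj := drift_part.
Local Notation b j := (col j B).

Definition noise_var (j : 'I_q) : R := quad_form Q (b j).

(* (1 + noise_var j * ts n)^(-1/2) *)
Definition kap n j : R := expR (- (2^-1 * ln (1 + noise_var j * ts n))).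

Definition drift_mx n : 'M[R]_r := 1%:M + ts n *: Aj.

(* Beats the quadratic growth of the logarithms of the weights. *)
Definition quartic_cut n (z : 'cV[R]_r) : R := expR (- (eps * ts n * `|z| ^+ 4)).

Definition tilted_drift n j : 'M[R]_r :=
  Aj - kap n j ^+ 2 *: (b j *m ((b j)^T *m Q *m drift_mx n)).

Definition weight n m z : R :=
  tilt_weight Q (Num.sqrt (ts n)) (fun=> drift_mx n) (fun m => b (idx m))
    (fun m => kap n (idx m)) (quartic_cut n) m z.

Let ts_gt0 n : 0 < ts n. Proof. by rewrite divr_gt0. Qed.
Let ts_ge0 n : 0 <= ts n. Proof. exact: ltW. Qed.

Let ts_le n : ts n <= t.
Proof. by rewrite /time_step ler_pdivrMr// ler_peMr ?(ltW t0)// ler1n. Qed.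

Let var_ge0 j : 0 <= noise_var j.
Proof. exact: Q0. Qed.

Let vt_ge0 n j : 0 <= noise_var j * ts n.
Proof. by apply: mulr_ge0; [exact: var_ge0|exact: ts_ge0]. Qed.

Let var1_gt0 n j : 0 < 1 + noise_var j * ts n.
Proof. by apply: ltr_wpDr; [exact: vt_ge0|]. Qed.

Lemma kap_gt0 n j : 0 < kap n j. Proof. exact: expR_gt0. Qed.

Lemma kap_eq n j :
  kap n j ^+ 2 * (1 + quad_form Q (b j) * Num.sqrt (ts n) ^+ 2) = 1.
Proof.
rewrite sqr_sqrtr// -[1 + _]lnK ?posrE ?var1_gt0// /kap expr2 -!expRD.
by rewrite -[RHS]expR0 /noise_var; congr expR; field.
Qed.

Let kap_sqE n j : 1 - kap n j ^+ 2 = kap n j ^+ 2 * (noise_var j * ts n).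
Proof.
by have := kap_eq n j; rewrite sqr_sqrtr// mulrDr mulr1 -/(noise_var j) => <-; ring.
Qed.

Let kap_sq_ge0 n j : 0 <= kap n j ^+ 2.
Proof. exact: sqr_ge0. Qed.

Let kap_sq_le1 n j : kap n j ^+ 2 <= 1.
Proof. by rewrite -subr_ge0 kap_sqE; apply: mulr_ge0; [|exact: vt_ge0]. Qed.

Lemma cvg_ln_var j : ln (1 + noise_var j * ts n) @[n --> \oo] --> (0 : R).
Proof.
apply: (@squeeze_cvgr _ _ _ _ (cst 0) (fun n => noise_var j * ts n)).
- near=> n; have vt0 := vt_ge0 n j; apply/andP; split; first by rewrite ln_ge0// lerDl.
  by rewrite le_ln1Dx// (lt_le_trans (ltrN10 _)).
- exact: cvg_cst.
- by rewrite -(mulr0 (noise_var j)); apply: cvgM; [exact: cvg_cst|exact: cvg_time_step].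
Unshelve. all: by end_near. Qed.

Lemma cvg_kap j : kap n j @[n --> \oo] --> (1 : R).
Proof.
rewrite -[1 in X in _ --> X]expR0 -oppr0 -(mulr0 2^-1).
apply: (cvg_comp_continuous (@continuous_expR R)).
by apply: (@cvgN _ R^o); apply: cvgM; [exact: cvg_cst|exact: cvg_ln_var].
Qed.

(** Squeezed by x / (1 + x) <= ln (1 + x) <= x at [x = noise_var j * ts n], where [kap n j ^+ 2] is
    1 / (1 + x). *)
Lemma cvg_ln_var_sum j :
  (n.+1%:R * ln (1 + noise_var j * ts n)) @[n --> \oo] --> noise_var j * t.
Proof.
have nts n : n.+1%:R * ts n = t := grid_last t n.
apply: (@squeeze_cvgr _ _ _ _ (fun n => noise_var j * t * kap n j ^+ 2)
  (cst (noise_var j * t))).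
- near=> n; apply/andP; split; last first.
    have -> : cst (noise_var j * t) n = n.+1%:R * (noise_var j * ts n).
      by rewrite mulrCA nts.
    apply: ler_wpM2l => //; apply: le_ln1Dx.
    exact: lt_le_trans (ltrN10 _) (vt_ge0 n j).
  have -> : noise_var j * t * kap n j ^+ 2 =
      n.+1%:R * (kap n j ^+ 2 * (noise_var j * ts n)) by rewrite [RHS]mulrCA [X in _ = _ * X]mulrCA nts; ring.
  apply: ler_wpM2l => //; rewrite -lerN2.
  (* The lower bound is ln (1 + y) <= y applied to [kap n j ^+ 2 = 1 + y]. *)
  have lk : ln (kap n j ^+ 2) = - ln (1 + noise_var j * ts n).
    by rewrite /kap expr2 -expRD expRK; field.
  rewrite -lk -{1}[kap n j ^+ 2](subKr 1) kap_sqE le_ln1Dx//.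
  by rewrite ltrN2 -kap_sqE gtrBl exprn_gt0// kap_gt0.
- rewrite -[X in _ --> X]mulr1 -(expr1n _ 2%N).
  apply: cvgM; first exact: cvg_cst.
  exact: (cvg_comp_continuous (@exprn_continuous R 2) (cvg_kap j)).
- exact: cvg_cst.
Unshelve. all: by end_near. Qed.

Let norm_trmx m k (M : 'M[R]_(m, k)) : `|M^T| <= `|M|.
Proof.
rewrite -[leLHS]/(mx_norm _) mx_normrE; apply/bigmax_leP; split=> // -[i j] _ /=.
by rewrite mxE coord_le_norm.
Qed.

Lemma bilin_bound (M : 'M[R]_r) (z : 'cV[R]_r) :
  (z^T *m M *m z) 0 0 <= r%:R * r%:R * `|M| * `|z| ^+ 2.
Proof.
apply: le_trans (ler_norm _) _; apply: le_trans (coord_le_norm _ _ _) _.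
apply: le_trans (norm_mulmx _ _) _.
have -> : r%:R * r%:R * `|M| * `|z| ^+ 2 = r%:R * (r%:R * `|z| * `|M|) * `|z|.
  by ring.
rewrite ler_wpM2r// ler_wpM2l//; apply: le_trans (norm_mulmx _ _) _.
by rewrite ler_wpM2r// ler_wpM2l.
Qed.

Lemma tilt_mx_tilted_drift n m :
  tilt_mx Q (Num.sqrt (ts n)) (fun=> drift_mx n) (fun m => b (idx m))
    (fun m => kap n (idx m)) m = 1%:M + ts n *: tilted_drift n (idx m).
Proof.
rewrite /tilt_mx sqr_sqrtr// /tilted_drift scalerBr addrA -/(drift_mx n).
by congr (_ - _); rewrite scalerA.
Qed.

Let norm_mulmx1 m (u : 'cV[R]_m) (v : 'rV[R]_m) : `|u *m v| <= `|u| * `|v|.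
Proof. by apply: le_trans (norm_mulmx _ _) _; rewrite mul1r. Qed.

Lemma tilted_drift_bounded : exists C, forall n j, `|tilted_drift n j| <= C.
Proof.
exists (`|Aj| + \sum_j `|b j| * (r%:R * `|(b j)^T *m Q| *
  (`|1%:M : 'M[R]_r| + t * `|Aj|))) => n j.
apply: le_trans (ler_normB _ _) _; rewrite lerD2l.
rewrite (bigD1 j)//=; apply: ler_wpDr.
  by apply: sumr_ge0 => i _; rewrite !mulr_ge0// addr_ge0// mulr_ge0// ltW.
rewrite normrZ ger0_norm//; apply: (@le_trans _ _ (1 * `|b j *m ((b j)^T *m Q *m drift_mx n)|)).
  by rewrite ler_wpM2r.
rewrite mul1r; apply: le_trans (norm_mulmx1 _ _) _; rewrite ler_wpM2l//.
apply: le_trans (norm_mulmx _ _) _; rewrite ler_wpM2l ?mulr_ge0//.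
apply: le_trans (ler_normD _ _) _; rewrite lerD2l normrZ ger0_norm//.
by rewrite ler_wpM2r.
Qed.

Let sum_b : \sum_j b j *m (b j)^T = Rm.
Proof.
rewrite -BB; apply/matrixP => i k; rewrite summxE mxE.
by apply: eq_bigr => j _; rewrite !mxE big_ord1 !mxE.
Qed.

(** The columns satisfy [\sum_j b j *m (b j)^T = Rm], and both [kap] and [drift_mx] tend to the
    identity; this produces the drift of the h-process. *)
Lemma cvg_tilted_drift :
  (\sum_j tilted_drift n j) @[n --> \oo] --> A - Rm *m Q.
Proof.
pose M1 j := b j *m ((b j)^T *m Q); pose M2 j := b j *m ((b j)^T *m Q *m Aj).
have E n : \sum_j tilted_drift n j = A - Rm *m Q +
    \sum_j ((1 - kap n j ^+ 2) *: M1 j - (kap n j ^+ 2 * ts n) *: M2 j).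
  have -> : A - Rm *m Q = \sum_j (Aj - M1 j).
    rewrite sumrB sumr_const card_ord -scaler_nat /drift_part scalerA.
    rewrite divff ?scale1r// -sum_b mulmx_suml; congr (_ - _).
    by apply: eq_bigr => j _; rewrite /M1 mulmxA.
  rewrite -big_split /=; apply: eq_bigr => j _.
  rewrite /tilted_drift /drift_mx [(b j)^T *m Q *m _]mulmxDr mulmx1.
  rewrite -scalemxAr mulmxDr -scalemxAr -/(M1 j) -/(M2 j).
  move: Aj (M1 j) (M2 j) => a1 a2 a3.
  by apply/matrixP => i l; rewrite !mxE; ring.
have S0 : (\sum_j ((1 - kap n j ^+ 2) * `|M1 j| + ts n * `|M2 j|)) @[n --> \oo]
    --> \sum_(j < q) ((1 - 1 ^+ 2) * `|M1 j| + 0 * `|M2 j|).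
  apply: cvg_ord_sum => j; apply: cvgD; last first.
    by apply: cvgM; [exact: cvg_time_step|exact: cvg_cst].
  apply: cvgM; last exact: cvg_cst.
  apply: (@cvgB _ R^o); first exact: cvg_cst.
  exact: (cvg_comp_continuous (@exprn_continuous R 2) (cvg_kap j)).
apply/cvgrPdist_le => e e0; move/cvgrPdist_le : S0 => /(_ _ e0).
apply: filterS => n; rewrite big1 => [|j _]; last by rewrite expr1n subrr !mul0r addr0.
rewrite sub0r normrN => h; apply: le_trans h; apply: le_trans (ler_norm _).
rewrite E opprD addrA subrr add0r normrN.
apply: le_trans (ler_norm_sum _ _ _) _; apply: ler_sum => j _.
apply: le_trans (ler_normB _ _) _; rewrite (normrZ _ (M1 j)) (normrZ _ (M2 j)) lerD//.
  by rewrite ger0_norm// subr_ge0.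
rewrite ger0_norm; last by apply: mulr_ge0.
by apply: ler_wpM2r => //; apply: ler_piMl.
Qed.

(** The terms come, in order, from [h0 z / h0 (D z)], from the completed square, and from the cut.
    The normalisation [1 / kap] is kept apart, since its logarithm does not depend on [z]. *)
Definition log_weight n j (z : 'cV[R]_r) : R :=
  (z^T *m (Q *m Aj) *m z) 0 0 + ts n / 2 * quad_form Q (Aj *m z)
  - 2^-1 * kap n j ^+ 2 * (((b j)^T *m Q *m z) 0 0 +
      ts n * ((b j)^T *m Q *m Aj *m z) 0 0) ^+ 2
  - eps * `|z| ^+ 4.

Lemma weightE n m z : weight n m z =
  expR (ts n * log_weight n (idx m) z + 2^-1 * ln (1 + noise_var (idx m) * ts n)).
Proof.
rewrite /weight /tilt_weight sqr_sqrtr// /quartic_cut /h0 /kap.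
rewrite -!expRD -expRN -!expRD; congr expR; rewrite -/(kap n (idx m)).
have -> : drift_mx n *m z = z + ts n *: (Aj *m z).
  by rewrite mulmxDl mul1mx scalemxAl.
rewrite quad_form_add// -scalemxAr scalemx00.
have -> : quad_form Q (ts n *: (Aj *m z)) = ts n ^+ 2 * quad_form Q (Aj *m z).
  rewrite /quad_form -scalemxAr [(ts n *: _)^T]linearZ /= -!scalemxAl.
  by rewrite scalerA scalemx00.
rewrite mulmxDr addmx00 -scalemxAr scalemx00 /log_weight !mulmxA.
by field.
Qed.

Lemma weight_ge0 n m z : 0 <= weight n m z.
Proof. by rewrite weightE expR_ge0. Qed.

Lemma log_weight_bounded : exists2 C, 0 <= C & forall n j z, log_weight n j z <= C.
Proof.
pose K := r%:R * r%:R * `|Q *m Aj| + t / 2 * (r%:R * r%:R * `|Aj^T *m Q *m Aj|).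
have K0 : 0 <= K by rewrite addr_ge0 ?mulr_ge0 ?divr_ge0// ltW.
(* The completed square has a favourable sign and is dropped. The constant is the maximum of
   [K u - eps u^2], with [u] standing for the squared norm of [z]. *)
exists (K ^+ 2 / (4 * eps)) => [|n j z].
  by rewrite divr_ge0 ?sqr_ge0// mulr_ge0// ltW.
apply: (@le_trans _ _ (K * `|z| ^+ 2 - eps * `|z| ^+ 4)).
  rewrite /log_weight lerB// lerBlDr -[leLHS]addr0 lerD//; last first.
    by apply: mulr_ge0; [apply: mulr_ge0|exact: sqr_ge0].
  rewrite /K mulrDl; apply: lerD; first exact: bilin_bound.
  rewrite -[leRHS]mulrA; apply: ler_pM.
  - by apply: mulr_ge0; [exact: ts_ge0|rewrite invr_ge0].
  - exact: Q0.
  - by apply: ler_wpM2r; [rewrite invr_ge0|exact: ts_le].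
  - by rewrite quad_form_mulmx; exact: bilin_bound.
have -> : `|z| ^+ 4 = (`|z| ^+ 2) ^+ 2 by rewrite -exprM.
set u := `|z| ^+ 2; rewrite ler_pdivlMr ?mulr_gt0//.
by have := sqr_ge0 (2 * eps * u - K); nra.
Qed.

End Weights.

Lemma prod_expR (R : realType) n (f : 'I_n -> R) :
  \prod_i expR (f i) = expR (\sum_i f i).
Proof. by rewrite (big_morph (@expR R) (@expRD R) (@expR0 R)). Qed.

Lemma sum_flat (V : nmodType) (q k : nat) (f : nat -> V) :
  \sum_(m < k * q) f m = \sum_(l < q) \sum_(a < k) f (a * q + l)%N.
Proof.
by have := sum_blocks q k 0 f; rewrite addn0 big_ord0 addr0 exchange_big.
Qed.

Section WeightLimits.
Variables (R : realType) (r p : nat) (t : R) (A Rm Sm Q : 'M[R]_r).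
Variables (B : 'M[R]_(r, p.+1)) (eps : R).
Local Notation mu := (@lebesgue_measure R).
Local Notation q := p.+1.
Local Notation ts := (time_step t).
Local Notation idx := (coord_index p).
Local Notation Aj := (drift_part p A).
Local Notation b j := (col j B).
Local Notation var := (noise_var Q B).
Hypotheses (t0 : 0 < t) (eps0 : 0 < eps) (sQ : Q^T = Q).
Hypothesis Q0 : forall z, 0 <= quad_form Q z.
Hypothesis BB : B *m B^T = Rm.
Hypothesis riccati : A^T *m Q + Q *m A - Q *m Rm *m Q + Sm = 0.

Let weight_prod n (Z : nat -> 'cV[R]_r) :
  \prod_(m < n.+1 * q) weight t A Q B eps n m (Z m) =
  expR (\sum_(m < n.+1 * q) (ts n * log_weight t A Q B eps n (idx m) (Z m) +
    2^-1 * ln (1 + var (idx m) * ts n))).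
Proof. by rewrite -prod_expR; apply: eq_bigr => m _; rewrite weightE. Qed.

(** Each substep contributes at most [ts n * (C + V)] to the exponent, and the steps add up to
    [t * q]; this bound, uniform in [n], is the one used for dominated convergence. *)
Lemma weight_prod_bounded : exists K, forall n (Z : nat -> 'cV[R]_r),
  \prod_(m < n.+1 * q) weight t A Q B eps n m (Z m) <= K.
Proof.
have [C C0 gC] := log_weight_bounded A B t0 eps0 Q0.
pose V := \sum_j var j.
have var0 j : 0 <= var j by exact: Q0.
have ts0 n : 0 <= ts n by rewrite ltW// divr_gt0.
exists (expR (t * q%:R * (C + V))) => n Z.
rewrite weight_prod ler_expR.
apply: (@le_trans _ _ (\sum_(m < n.+1 * q) ts n * (C + V))).
  apply: ler_sum => m _; rewrite [leRHS]mulrDr; apply: lerD; first by apply: ler_wpM2l.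
  have vV : var (idx m) <= V by rewrite /V (bigD1 (idx m))//= lerDl sumr_ge0.
  have vt0 : 0 <= var (idx m) * ts n by apply: mulr_ge0; [exact: var0|exact: ts0].
  have : ln (1 + var (idx m) * ts n) <= var (idx m) * ts n.
    by apply: le_ln1Dx; exact: lt_le_trans (ltrN10 _) vt0.
  have : var (idx m) * ts n <= ts n * V by rewrite mulrC ler_wpM2l.
  lra.
rewrite sumr_const card_ord -[leLHS]mulr_natl natrM.
have gl : n.+1%:R * ts n = t := grid_last t n.
have -> : n.+1%:R * q%:R * (ts n * (C + V)) = (n.+1%:R * ts n) * q%:R * (C + V) by ring.
by rewrite gl.
Qed.

Let quartic_cont : continuous (fun z : 'cV[R]_r => `|z| ^+ 4).
Proof. by apply: continuous_pow => z; exact: norm_continuous. Qed.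

Let fu j (z : 'cV[R]_r) : R := ((b j)^T *m Q *m z) 0 0.
Let fv j (z : 'cV[R]_r) : R := ((b j)^T *m Q *m Aj *m z) 0 0.
Let f1 (z : 'cV[R]_r) : R := quad_form (Q *m Aj) z.
Let f2 (z : 'cV[R]_r) : R := quad_form Q (Aj *m z).
(** The formal limit of [log_weight], with [ts = 0] and [kap = 1]. *)
Let g j (z : 'cV[R]_r) : R := f1 z - 2^-1 * fu j z ^+ 2 - eps * `|z| ^+ 4.

Let cfu j : continuous (fu j). Proof. exact: continuous_mulmx_coord. Qed.
Let cfv j : continuous (fv j). Proof. exact: continuous_mulmx_coord. Qed.
Let cf1 : continuous f1. Proof. exact: continuous_quad_form. Qed.
Let cf2 : continuous f2.
Proof.
have -> : f2 = quad_form (Aj^T *m Q *m Aj).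
  by apply/funext => z; rewrite /f2 quad_form_mulmx.
exact: continuous_quad_form.
Qed.

Let cg j : continuous (g j).
Proof.
apply: continuous_sub; first apply: continuous_sub => //.
  apply: continuous_mul; first exact: continuous_cst.
  exact: continuous_pow.
by apply: continuous_mul => //; exact: continuous_cst.
Qed.

(** Here the potential appears: by the Riccati equation, z'QAz - z'QRQz / 2 = - z'Sz / 2. *)
Let g_sum z : \sum_j g j z = - (potential Sm z + eps * q%:R * `|z| ^+ 4).
Proof.
have u2 : \sum_j fu j z ^+ 2 = quad_form (Q *m Rm *m Q) z.
  have -> : quad_form (Q *m Rm *m Q) z = ((B^T *m Q *m z)^T *m (B^T *m Q *m z)) 0 0.
    by rewrite /quad_form -BB !trmx_mul trmxK sQ !mulmxA.
  rewrite mxE; apply: eq_bigr => j _; rewrite mxE -expr2; congr (_ ^+ 2).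
  by rewrite /fu tr_col -!row_mul [LHS]mxE.
have u3 : \sum_j 2^-1 * fu j z ^+ 2 = 2^-1 * quad_form (Q *m Rm *m Q) z.
  by rewrite -u2 mulr_sumr.
rewrite /g !sumrB u3 !sumr_const !card_ord.
rewrite -[f1 z *+ q]mulr_natl /f1 /drift_part -scalemxAr quad_formZ mulrA divff// mul1r.
have := congr1 (fun M => quad_form M z) riccati.
have t3 : quad_form (A^T *m Q) z = quad_form (Q *m A) z.
  by rewrite -[RHS]quad_form_tr trmx_mul sQ.
have q0 : quad_form 0 z = 0 by rewrite /quad_form mulmx0 mul0mx mxE.
rewrite !quad_formD -[- (Q *m _ *m _)]scaleN1r quad_formZ t3 q0 /potential => e.
rewrite -[eps * _ *+ _]mulr_natl; lra.
Qed.

Let var_sum : \sum_j var j = \tr (Rm *m Q).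
Proof.
rewrite -BB -mulmxA mxtrace_mulC /mxtrace; apply: eq_bigr => j _.
rewrite /noise_var /quad_form tr_col -mulmxA -row_mul mxE [LHS]mxE.
rewrite -mulmxA [RHS]mxE; apply: eq_bigr => l _; congr (_ * _);
  by rewrite !mxE; apply: eq_bigr => i _; rewrite !mxE.
Qed.

Section Limit.
Variables (X : R -> 'cV[R]_r) (Z : nat -> nat -> 'cV[R]_r).
Hypotheses (cX : continuous X) (ZX : tracks p t X Z).

Let cvg_column j : (\sum_(a < n.+1)
    (ts n * log_weight t A Q B eps n j (Z n (a * q + j)%N) +
     2^-1 * ln (1 + var j * ts n))) @[n --> \oo] -->
  \int[mu]_(s in `[0, t]) g j (X s) + 2^-1 * (var j * t).
Proof.
have RS f (cf : continuous f) := tracks_riemann t0 cX ZX j cf.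
pose S f n := \sum_(a < n.+1) ts n * f (Z n (a * q + j)%N).
(* An exact expansion: [log_weight] is [g j] plus terms whose coefficients vanish as [n] grows, each
   multiplied by a convergent Riemann sum. *)
have -> : (fun n => \sum_(a < n.+1)
    (ts n * log_weight t A Q B eps n j (Z n (a * q + j)%N) +
     2^-1 * ln (1 + var j * ts n))) =
  (fun n => S (g j) n + ts n / 2 * S f2 n
     + 2^-1 * (1 - kap t Q B n j ^+ 2) * S (fun z => fu j z ^+ 2) n
     - kap t Q B n j ^+ 2 * ts n * S (fun z => fu j z * fv j z) n
     - 2^-1 * kap t Q B n j ^+ 2 * ts n ^+ 2 * S (fun z => fv j z ^+ 2) n
     + 2^-1 * (n.+1%:R * ln (1 + var j * ts n))).
  apply/funext => n; rewrite big_split /= sumr_const card_ord.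
  congr (_ + _); last by rewrite -[LHS]mulr_natl mulrCA.
  rewrite /S !mulr_sumr -!sumrN -!big_split /=; apply: eq_bigr => a _.
  by rewrite /log_weight /g /f1 /f2 /fu /fv /quad_form; field.
have k2 : kap t Q B n j ^+ 2 @[n --> \oo] --> (1 : R).
  have := cvg_comp_continuous (@exprn_continuous R 2) (cvg_kap B t0 Q0 j).
  by rewrite expr1n.
have ts_cvg := cvg_time_step t.
have -> : \int[mu]_(s in `[0, t]) g j (X s) + 2^-1 * (var j * t) =
    \int[mu]_(s in `[0, t]) g j (X s)
     + 0 / 2 * \int[mu]_(s in `[0, t]) f2 (X s)
     + 2^-1 * (1 - 1) * \int[mu]_(s in `[0, t]) (fu j (X s) ^+ 2)
     - 1 * 0 * \int[mu]_(s in `[0, t]) (fu j (X s) * fv j (X s))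
     - 2^-1 * 1 * 0 ^+ 2 * \int[mu]_(s in `[0, t]) (fv j (X s) ^+ 2)
     + 2^-1 * (var j * t) by ring.
have ccst (a : R) : a @[_ --> \oo] --> a by exact: cvg_cst.
apply: (@cvgD _ R^o); last first.
  by apply: cvgM => //; exact: cvg_ln_var_sum.
apply: (@cvgB _ R^o); last first.
  apply: cvgM; last by apply: RS; exact: continuous_pow.
  apply: cvgM; first by apply: cvgM.
  exact: (cvg_comp_continuous (@exprn_continuous R 2) ts_cvg).
apply: (@cvgB _ R^o); last first.
  apply: cvgM; last by apply: RS; exact: continuous_mul.
  by apply: cvgM.
apply: (@cvgD _ R^o); last first.
  apply: cvgM; last by apply: RS; exact: continuous_pow.
  by apply: cvgM => //; apply: (@cvgB _ R^o).
apply: (@cvgD _ R^o); first exact: RS.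
by apply: cvgM; [apply: cvgM|exact: RS].
Qed.

Lemma weight_prod_cvg :
  (\prod_(m < n.+1 * q) weight t A Q B eps n m (Z n m)) @[n --> \oo] -->
  expR (2^-1 * \tr (Rm *m Q) * t -
    \int[mu]_(s in `[0, t]) (potential Sm (X s) + eps * q%:R * `|X s| ^+ 4)).
Proof.
under eq_fun do rewrite weight_prod.
apply: (cvg_comp_continuous (@continuous_expR R)).
have -> : 2^-1 * \tr (Rm *m Q) * t -
    \int[mu]_(s in `[0, t]) (potential Sm (X s) + eps * q%:R * `|X s| ^+ 4) =
  \sum_j (\int[mu]_(s in `[0, t]) g j (X s) + 2^-1 * (var j * t)).
  rewrite big_split /= -mulr_sumr -mulr_suml var_sum mulrA addrC; congr (_ + _).
  rewrite -Rintegral_ord_sum; last first.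
    move=> j s; apply: (@continuous_comp _ _ _ X (g j)); [exact: cX|exact: cg].
  under [RHS]eq_Rintegral do rewrite g_sum -mulN1r.
  rewrite RintegralZl ?mulN1r//.
  apply: integrable_continuous => s.
  apply: (@continuous_comp _ _ _ X (fun z => potential Sm z + eps * q%:R * `|z| ^+ 4)).
    exact: cX.
  apply: continuous_add; apply: continuous_mul => //; try exact: continuous_cst.
  exact: continuous_quad_form.
under eq_fun do rewrite (sum_flat q _ (fun m => ts _ * log_weight t A Q B eps _ (idx m) (Z _ m) +
  2^-1 * ln (1 + var (idx m) * ts _))).
apply: cvg_ord_sum => j.
under eq_fun do under eq_bigr do rewrite coord_index_block.
exact: cvg_column.
Qed.

Lemma cut_prod_cvg :
  (\prod_(m < n.+1 * q) quartic_cut t eps n (Z n m)) @[n --> \oo] -->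
  expR (- (eps * q%:R * \int[mu]_(s in `[0, t]) (`|X s| ^+ 4))).
Proof.
under eq_fun do rewrite prod_expR.
apply: (cvg_comp_continuous (@continuous_expR R)).
have -> : - (eps * q%:R * \int[mu]_(s in `[0, t]) (`|X s| ^+ 4)) =
    \sum_(j < q) - (eps * \int[mu]_(s in `[0, t]) (`|X s| ^+ 4)).
  by rewrite sumr_const card_ord -[RHS]mulr_natl; ring.
under eq_fun do rewrite (sum_flat q _ (fun m => - (eps * ts _ * `|Z _ m| ^+ 4))).
apply: cvg_ord_sum => j.
have -> : (fun n => \sum_(a < n.+1) - (eps * ts n * `|Z n (a * q + j)%N| ^+ 4)) =
  (fun n => - (eps * \sum_(a < n.+1) ts n * `|Z n (a * q + j)%N| ^+ 4)).
  apply/funext => n; rewrite mulr_sumr -sumrN; apply: eq_bigr => a _.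
  by rewrite mulrA.
apply: (@cvgN _ R^o); apply: cvgM; first exact: cvg_cst.
exact: (tracks_riemann t0 cX ZX j quartic_cont).
Qed.

End Limit.
End WeightLimits.

(** * Passage to the limit in the Girsanov formula *)

Section AlmostEverywhere.
Context d (T : measurableType d) (R : realType) (P : probability T R).

Import HBNNSimple.

(* No measurability of [f] and [g] is needed: the simple functions below [f],
   cut off on the exceptional set, are below [g]. *)
Lemma ge0_ae_le_integral (f g : T -> \bar R) :
  (forall w, (0 <= f w)%E) -> (forall w, (0 <= g w)%E) ->
  {ae P, forall w, (f w <= g w)%E} ->
  (\int[P]_w f w <= \int[P]_w g w)%E.
Proof.
move=> f0 g0 [N [mN N0 subN]].
rewrite ge0_integralTE//; apply: ub_ereal_sup => _ [h hf <-].
have mNc : measurable (~` N) by exact: measurableC.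
have pE w : proj_nnsfun h mNc w = h w * \1_(~` N) w by [].
have -> : sintegral P h = sintegral P (proj_nnsfun h mNc).
  rewrite -!integralT_nnsfun; apply: ge0_ae_eq_integral => //.
  - exact/measurable_EFinP.
  - exact/measurable_EFinP.
  - by move=> w _; rewrite lee_fin.
  - by move=> w _; rewrite lee_fin.
  exists N; split => // w; apply: contra_notP => Nw _.
  by congr EFin; rewrite [RHS]pE indicE mem_set ?mulr1.
rewrite ge0_integralTE//; apply: ereal_sup_ubound; exists (proj_nnsfun h mNc) => // w.
rewrite pE indicE; have [/set_mem Nw|_] := boolP (w \in ~` N); last by rewrite mulr0.
rewrite mulr1; apply: le_trans (hf w) _.
by apply: contrapT => fg; apply: Nw; exact: subN.
Qed.

Lemma ge0_ae_integral (f g : T -> \bar R) :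
  (forall w, (0 <= f w)%E) -> (forall w, (0 <= g w)%E) ->
  {ae P, forall w, f w = g w} -> (\int[P]_w f w = \int[P]_w g w)%E.
Proof.
move=> f0 g0 fg; apply/eqP; rewrite eq_le !ge0_ae_le_integral//.
  by apply: filterS fg => w ->.
by apply: filterS fg => w ->.
Qed.

Lemma ge0_ae_integral_cst (f : T -> \bar R) (c : \bar R) :
  (forall w, (0 <= f w)%E) -> (0 <= c)%E -> {ae P, forall w, f w = c} ->
  (\int[P]_w f w = c)%E.
Proof.
move=> f0 c0 fc; rewrite (@ge0_ae_integral f (cst c))//.
by rewrite integral_cst// [X in (_ * X)%E]probability_setT mule1.
Qed.

(** Almost everywhere limits of measurable functions are of this kind, while [P] need not be
    complete. *)
Definition ae_measurable (u : T -> R) : Prop :=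
  exists2 v : T -> R, measurable_fun setT v & {ae P, forall w, v w = u w}.

Lemma measurable_ae_measurable (u : T -> R) :
  measurable_fun setT u -> ae_measurable u.
Proof. by move=> mu; exists u => //; exact: aeW. Qed.

Lemma ae_measurable_cvg (u_ : nat -> T -> R) (u : T -> R) :
  (forall n, ae_measurable (u_ n)) ->
  {ae P, forall w, u_ n w @[n --> \oo] --> u w} -> ae_measurable u.
Proof.
move=> mu uu.
have /choice[v vP] : forall n, exists v : T -> R, measurable_fun setT v /\
    {ae P, forall w, v w = u_ n w} by move=> n; have [v] := mu n; exists v.
have vu : {ae P, forall w, v n w @[n --> \oo] --> u w}.
  apply: filterS2 (ae_foralln (fun n => (vP n).2)) uu => w vw uw.
  by have -> : (fun n => v n w) = (fun n => u_ n w) by apply/funext => n; exact: vw.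
have [N [mN N0 subN]] := vu.
have mNc : measurable (~` N) by exact: measurableC.
exists (fun w => u w * \1_(~` N) w).
  apply/measurable_EFinP.
  apply: (@emeasurable_fun_cvg _ _ _ _ (fun n w => (v n w * \1_(~` N) w)%:E)).
    move=> n; apply/measurable_EFinP; apply: measurable_funM; first exact: (vP n).1.
    exact: measurable_indic.
  move=> w _; apply/cvg_EFin; first by near=> n.
  rewrite indicE; have [/set_mem Nw|Nw] := boolP (w \in ~` N).
    under eq_fun do rewrite /= mulr1; rewrite mulr1.
    by apply: contrapT => h; apply: Nw; exact: subN.
  by under eq_fun do rewrite /= mulr0; rewrite mulr0; exact: cvg_cst.
exists N; split => // w; apply: contra_notP => Nw.
by rewrite /= indicE mem_set ?mulr1.
Unshelve. all: by end_near. Qed.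

Lemma bounded_ae_cvg (u_ : nat -> T -> R) (u : T -> R) (K : R) :
  (forall n, ae_measurable (u_ n)) ->
  (forall n w, 0 <= u_ n w) -> (forall w, 0 <= u w) ->
  {ae P, forall w, forall n, u_ n w <= K} ->
  {ae P, forall w, u_ n w @[n --> \oo] --> u w} ->
  (\int[P]_w (u_ n w)%:E @[n --> \oo] --> \int[P]_w (u w)%:E)%E.
Proof.
move=> mu u_0 u0 uK uu.
(* Absolute values make the measurable versions nonnegative everywhere, as [ge0_ae_integral]
   demands. *)
have abs_meas (f : T -> R) : (forall w, 0 <= f w) -> ae_measurable f ->
    exists v : T -> R, [/\ measurable_fun setT v, forall w, 0 <= v w &
      {ae P, forall w, v w = f w}].
  move=> f0 [v mv vf]; exists (fun w => `|v w|); split => //.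
    exact: measurableT_comp.
  by apply: filterS vf => w ->; rewrite ger0_norm.
have /choice[v vP] := fun n => abs_meas _ (u_0 n) (mu n).
have [v' [mv' v'0 v'u]] := abs_meas _ u0 (ae_measurable_cvg mu uu).
have uv n : (\int[P]_w (u_ n w)%:E = \int[P]_w (v n w)%:E)%E.
  have [_ v0 vu] := vP n; apply: ge0_ae_integral => [w|w|].
  - by rewrite lee_fin.
  - by rewrite lee_fin.
  - by apply: filterS vu => w ->.
have uv' : (\int[P]_w (u w)%:E = \int[P]_w (v' w)%:E)%E.
  apply: ge0_ae_integral => [w|w|].
  - by rewrite lee_fin.
  - by rewrite lee_fin.
  - by apply: filterS v'u => w ->.
under eq_fun do rewrite uv; rewrite uv'.
have vv : {ae P, forall w n, v n w = u_ n w}.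
  by apply: ae_foralln => n; have [] := vP n.
have [] := @dominated_convergence _ T R P setT measurableT
  (fun n w => (v n w)%:E) (fun w => (v' w)%:E) (cst K%:E) _ _ _ _ _ => //.
- by move=> n; apply/measurable_EFinP; have [] := vP n.
- exact/measurable_EFinP.
- apply: filterS3 vv v'u uu => w vw v'w uw _.
  apply/cvg_EFin; first by near=> n.
  rewrite v'w; have -> : fine \o (fun n => (v n w)%:E) = (fun n => u_ n w).
    by apply/funext => n; exact: vw.
  exact: uw.
- exact: finite_measure_integrable_cst.
- apply: filterS2 vv uK => w vw uw n _.
  by rewrite vw /= lee_fin ger0_norm.
Unshelve. all: by end_near. Qed.

End AlmostEverywhere.

Lemma continuous_clamp (R : realType) (V : topologicalType) (f : R -> V) :
  {within `[0, +oo[, continuous f} -> continuous (fun s : R => f (Num.max 0 s)).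
Proof.
move=> /subspace_continuousP cf s.
have maxp (u : R) : `[0, +oo[%classic (Num.max 0 u).
  by have h : 0 <= Num.max 0 u; [rewrite le_max lexx|rewrite /= in_itv /= h].
apply: cvg_comp (cf _ (maxp s)) => U /=.
rewrite /within /= => nU.
have cm : continuous (fun u : R => Num.max 0 u).
  move=> u; exact: (@continuous_max R R (cst 0) id u (@cvg_cst _ _ _ _ _) (@cvg_id _ _)).
have h : nbhs s [set u : R | `[0, +oo[%classic (Num.max 0 u) -> U (Num.max 0 u)].
  exact: cm s _ nU.
have : nbhs s [set u : R | U (Num.max 0 u)].
  by apply: filterS h => u; apply; exact: maxp.
by [].
Qed.

(** * Brownian increments as independent Gaussian noise *)

Section Noise.
Context d (T : measurableType d) (R : realType) (P : probability T R).
Variables (p : nat) (t : R) (W : process P p.+1).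
Local Notation q := p.+1.
Hypotheses (t0 : 0 < t) (BM : brownian_motion W).

Let path (w : T) : R -> 'cV[R]_q := sample_path W w.

Lemma measurable_process_coord n (Y : process P n) s i :
  measurable_fun setT (fun w : T => (sample_path Y w s) i 0).
Proof. exact: (measurableT_comp (measurable_coord i)). Qed.

Lemma measurable_noise_path n m :
  measurable_fun setT (fun w : T => noise t (path w) n m).
Proof.
rewrite /noise /path.
have -> : (fun w : T => (sample_path W w (grid t n (m %/ q).+1) -
    sample_path W w (grid t n (m %/ q))) (coord_index p m) 0) =
  (fun w : T => (sample_path W w (grid t n (m %/ q).+1)) (coord_index p m) 0 -
    (sample_path W w (grid t n (m %/ q))) (coord_index p m) 0).
  by apply/funext => w; rewrite mxE [X in _ + X]mxE.
by apply: measurable_funB; exact: measurable_process_coord.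
Qed.

Lemma noise_iid n (E : nat -> set R) : (forall m, measurable (E m)) ->
  P [set w | forall m, (m < n.+1 * q)%N -> E m (noise t (path w) n m)] =
  (\prod_(m < n.+1 * q) normal_prob 0 (Num.sqrt (time_step t n)) (E m))%E.
Proof.
move=> mE; have [_ _ indep gauss] := BM.
(* The constraints of one block, gathered into a set of vectors: independence between blocks comes
   from the independent increments, and within a block from the independent coordinates. *)
pose E' i : set (borel_cV R q) := [set y | forall j : 'I_q, E (i * q + j)%N (y j 0)].
have mE' i : measurable (E' i).
  have -> : E' i = \bigcap_(j in [set: 'I_q])
      ((fun y : borel_cV R q => (y : 'cV[R]_q) j 0) @^-1` E (i * q + j)%N).
    by apply/seteqP; split => y yE j; have := yE j; rewrite /=; auto.
  apply: fin_bigcap_measurable; first exact: finite_finset.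
  by move=> j _; rewrite -[X in measurable X]setTI; exact: measurable_coord.
have step a : grid t n a.+1 = grid t n a + time_step t n.
  by rewrite /grid -natr1 mulrDl mul1r.
have ts0 : 0 < time_step t n by rewrite divr_gt0.
have grid0 a : 0 <= grid t n a by rewrite mulr_ge0// ltW.
have -> : [set w | forall m, (m < n.+1 * q)%N -> E m (noise t (path w) n m)] =
    [set w | forall i, (i < n.+1)%N ->
       E' i (increment W (grid t n i) (grid t n i.+1) w)].
  apply/seteqP; split=> w Ew.
    move=> i ni j; have := Ew (i * q + j)%N.
    rewrite /noise coord_index_block div_block; apply.
    apply: (@leq_trans (i.+1 * q)); first by rewrite mulSnr ltn_add2l.
    by rewrite leq_mul2r ni orbT.
  move=> m mn; have jq : (m %% q < q)%N by rewrite ltn_mod.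
  have idxE : coord_index p m = Ordinal jq by apply: val_inj; rewrite /= inordK.
  have := Ew (m %/ q)%N _ (Ordinal jq); rewrite /= -divn_eq /noise idxE; apply.
  by rewrite ltn_divLR.
rewrite indep//; last by move=> i j ij; rewrite ler_wpM2r ?ler_nat// ltW.
have := @big_blocks _ 1%E mule q n.+1 0
  (fun m => normal_prob 0 (Num.sqrt (time_step t n)) (E m)).
rewrite addn0 big_ord0 Monoid.mulm1 => ->; apply: eq_bigr => i _.
have -> : time_step t n = grid t n i.+1 - grid t n i by rewrite step addrC addKr.
by rewrite -gauss// step ltrDl.
Qed.

End Noise.

Section Clamped.
Context d (T : measurableType d) (R : realType) (P : probability T R).

(* Continuous on the whole line, whereas nothing is known of the sample paths at
   negative times. *)
Definition clamped_path n (Y : process P n) (w : T) (s : R) : 'cV[R]_n :=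
  sample_path Y w (Num.max 0 s).

Lemma clamped_pathE n (Y : process P n) w s : 0 <= s ->
  clamped_path Y w s = sample_path Y w s.
Proof. by move=> s0; rewrite /clamped_path max_r. Qed.

Lemma eq_Rintegral_clamped n (Y : process P n) w (f : 'cV[R]_n -> R) s :
  \int[lebesgue_measure]_(u in `[0, s]) f (clamped_path Y w u) =
  \int[lebesgue_measure]_(u in `[0, s]) f (sample_path Y w u).
Proof.
apply: eq_Rintegral => u; rewrite inE /= in_itv /= => /andP[u0 _].
by rewrite clamped_pathE.
Qed.

Lemma clamped_solution n1 n2 (F : 'M[R]_n1) (B : 'M[R]_(n1, n2)) (W : process P n2)
    (x : 'cV[R]_n1) (Y : process P n1) :
  brownian_motion W -> linear_sde_solution F B W x Y ->
  {ae P, forall w, [/\ continuous (clamped_path W w), continuous (clamped_path Y w),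
    clamped_path W w 0 = 0 &
    forall s, 0 <= s -> clamped_path Y w s =
      x + (\col_i \int[lebesgue_measure]_(u in `[0%R, s])
             ((F *m clamped_path Y w u) i 0)) + B *m clamped_path W w s]}.
Proof.
move=> [W0 cW _ _] [cY sol]; near=> w; split.
- by apply: continuous_clamp; near: w.
- by apply: continuous_clamp; near: w.
- by rewrite clamped_pathE//; near: w.
move=> s s0; rewrite !clamped_pathE//.
have -> : sample_path Y w s = x + (\col_i \int[lebesgue_measure]_(u in `[0%R, s])
    ((F *m sample_path Y w u) i 0)) + B *m sample_path W w s.
  by move: s s0; near: w.
congr (_ + _ + _); apply/matrixP => i j; rewrite [LHS]mxE [RHS]mxE.
by rewrite (eq_Rintegral_clamped Y w (fun y => (F *m y) i 0)).
Unshelve. all: by end_near. Qed.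

End Clamped.

Section TruncatedGirsanov.
Context d (T : measurableType d) (R : realType) (P : probability T R).
Variables (r p : nat) (t : R) (A Rm Sm Q : 'M[R]_r) (B : 'M[R]_(r, p.+1)).
Variables (x : 'cV[R]_r) (W : process P p.+1) (X Xh : process P r).
Local Notation q := p.+1.
Local Notation mu := (@lebesgue_measure R).
Local Notation ts := (time_step t).
Local Notation idx := (coord_index p).
Hypotheses (t0 : 0 < t) (sQ : Q^T = Q).
Hypothesis Q0 : forall z, 0 <= quad_form Q z.
Hypothesis S0 : forall z, 0 <= quad_form Sm z.
Hypothesis BB : B *m B^T = Rm.
Hypothesis riccati : A^T *m Q + Q *m A - Q *m Rm *m Q + Sm = 0.
Hypothesis BM : brownian_motion W.
Hypothesis solX : linear_sde_solution A B W x X.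
Hypothesis solH : linear_sde_solution (A - Rm *m Q) B W x Xh.

Let lam := 2^-1 * \tr (Rm *m Q).

Let zX n w : nat -> 'cV[R]_r :=
  chain (affine_step (fun=> drift_mx p t A n) (fun=> 1) (fun m => col (idx m) B)) x
    (noise t (sample_path W w) n).

Let zH n w : nat -> 'cV[R]_r :=
  chain (affine_step (tilt_mx Q (Num.sqrt (ts n)) (fun=> drift_mx p t A n)
           (fun m => col (idx m) B) (fun m => kap t Q B n (idx m)))
         (fun m => kap t Q B n (idx m)) (fun m => col (idx m) B)) x
    (noise t (sample_path W w) n).

Let noise_clamped n w m :
  noise t (clamped_path W w) n m = noise t (sample_path W w) n m.
Proof.
have g0 a : 0 <= grid t n a.
  by apply: mulr_ge0 => //; apply: divr_ge0 => //; exact: ltW.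
by rewrite /noise !clamped_pathE.
Qed.

Let tracks_zX : {ae P, forall w,
  continuous (clamped_path X w) /\ tracks p t (clamped_path X w) (zX ^~ w)}.
Proof.
apply: filterS (clamped_solution BM solX) => w [cW cX W0 eX]; split => //.
have -> : zX ^~ w = euler t B x (clamped_path W w)
    (fun _ _ => drift_part p A) (fun _ _ => 1).
  apply/funext => n; apply/funext => m; rewrite /zX /euler.
  by congr chain; apply/funext => i; rewrite noise_clamped.
apply: (euler_tracks t0 cW cX W0 eX (C := `|drift_part p A|)) => //.
- rewrite sumr_const card_ord -scaler_nat /drift_part scalerA divff// scale1r.
  exact: cvg_cst.
- by move=> j; exact: cvg_cst.
Qed.

Let tracks_zH : {ae P, forall w,
  continuous (clamped_path Xh w) /\ tracks p t (clamped_path Xh w) (zH ^~ w)}.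
Proof.
apply: filterS (clamped_solution BM solH) => w [cW cX W0 eX]; split => //.
have -> : zH ^~ w = euler t B x (clamped_path W w)
    (tilted_drift t A Q B) (kap t Q B).
  apply/funext => n; apply/funext => m; rewrite /zH /euler.
  congr chain; last by apply/funext => i; rewrite noise_clamped.
  by congr affine_step; apply/funext => i; rewrite tilt_mx_tilted_drift.
have [C LC] := tilted_drift_bounded A B t0 Q0.
apply: (euler_tracks t0 cW cX W0 eX LC).
- exact: cvg_tilted_drift.
- by move=> j; exact: cvg_kap.
Qed.

Let measurable_chain_W n L k m : measurable_fun setT
  ((fun w : T => chain (affine_step L k (fun m => col (idx m) B)) x
     (noise t (sample_path W w) n) m) : T -> borel_cV R r).
Proof.
apply: (measurable_chain (Y := borel_cV R r) (U := measurableTypeR R)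
  (zeta := fun m w => noise t (sample_path W w) n m)).
  by move=> i; exact: measurable_affine_step.
by move=> i _; exact: measurable_noise_path.
Qed.

Lemma continuous_quartic eps n : continuous (@quartic_cut R r t eps n).
Proof.
apply: continuous_exp; apply: continuous_opp; apply: continuous_mul.
  exact: continuous_cst.
by apply: continuous_pow => z; exact: norm_continuous.
Qed.

Let measurable_prod_chain (f : nat -> 'cV[R]_r -> R) (Z : T -> nat -> 'cV[R]_r) N :
  (forall m, continuous (f m)) ->
  (forall m, measurable_fun setT ((fun w => Z w m) : T -> borel_cV R r)) ->
  measurable_fun setT (fun w => \prod_(m < N) f m (Z w m)).
Proof.
move=> cf mZ; under eq_fun do rewrite -(big_mkord xpredT (fun m => f m (Z _ m))).
apply: measurable_prod => m _.
exact: (measurableT_comp (continuous_measurable_cV (cf m)) (mZ m)).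
Qed.

Section Truncation.
Variables (eps H : R) (g : 'cV[R]_r -> R).
Hypotheses (eps0 : 0 < eps) (cg : continuous g) (g0 : forall z, 0 <= g z).
Hypotheses (gH : forall z, g z <= H) (ghH : forall z, g z * h0 Q z <= H).

Let Ln n w := (\prod_(m < n.+1 * q) weight t A Q B eps n m (zX n w m)) *
  (g (zX n w (n.+1 * q)%N) * h0 Q (zX n w (n.+1 * q)%N)).

Let Rn n w := (\prod_(m < n.+1 * q) quartic_cut t eps n (zH n w m)) *
  g (zH n w (n.+1 * q)%N).

Definition lhs_limit (w : T) : R :=
  expR (lam * t - \int[mu]_(s in `[0, t])
    (potential Sm (clamped_path X w s) + eps * q%:R * `|clamped_path X w s| ^+ 4)) *
  (g (clamped_path X w t) * h0 Q (clamped_path X w t)).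

Definition rhs_limit (w : T) : R :=
  expR (- (eps * q%:R * \int[mu]_(s in `[0, t]) (`|clamped_path Xh w s| ^+ 4))) *
  g (clamped_path Xh w t).

Let cgh : continuous (fun z => g z * h0 Q z).
Proof. by apply: continuous_mul => //; exact: continuous_h0. Qed.

Let Ln_meas n : ae_measurable P (Ln n).
Proof.
apply: measurable_ae_measurable; apply: measurable_funM.
  apply: measurable_prod_chain => m; last exact: measurable_chain_W.
  apply: continuous_tilt_weight => [i|]; first exact: kap_gt0.
  exact: continuous_quartic.
exact: (measurableT_comp (continuous_measurable_cV cgh) (measurable_chain_W _ _ _ _)).
Qed.

Let Rn_meas n : ae_measurable P (Rn n).
Proof.
apply: measurable_ae_measurable; apply: measurable_funM.
  apply: (measurable_prod_chain (f := fun=> quartic_cut t eps n)) => m.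
    exact: continuous_quartic.
  exact: measurable_chain_W.
exact: (measurableT_comp (continuous_measurable_cV cg) (measurable_chain_W _ _ _ _)).
Qed.

Let Ln_cvg : {ae P, forall w, Ln n w @[n --> \oo] --> lhs_limit w}.
Proof.
apply: filterS tracks_zX => w [cX trX].
apply: cvgM; first exact: (weight_prod_cvg t0 sQ Q0 BB riccati cX trX).
exact: (tracks_last trX cgh).
Qed.

Let Rn_cvg : {ae P, forall w, Rn n w @[n --> \oo] --> rhs_limit w}.
Proof.
apply: filterS tracks_zH => w [cX trX].
apply: cvgM; first exact: (cut_prod_cvg t0 cX trX).
exact: (tracks_last trX cg).
Qed.

Let Ln_ge0 n w : 0 <= Ln n w.
Proof.
rewrite mulr_ge0 ?mulr_ge0// ?(ltW (h0_gt0 _ _))//.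
by apply: prodr_ge0 => m _; exact: weight_ge0.
Qed.

Let Rn_ge0 n w : 0 <= Rn n w.
Proof. by rewrite mulr_ge0// prodr_ge0// => m _; exact: expR_ge0. Qed.

Lemma lhs_limit_ge0 w : 0 <= lhs_limit w.
Proof. by rewrite mulr_ge0 ?expR_ge0// mulr_ge0// ltW// h0_gt0. Qed.

Lemma rhs_limit_ge0 w : 0 <= rhs_limit w.
Proof. by rewrite mulr_ge0 ?expR_ge0. Qed.

Lemma ae_measurable_lhs_limit : ae_measurable P lhs_limit.
Proof. exact: ae_measurable_cvg Ln_meas Ln_cvg. Qed.

Lemma ae_measurable_rhs_limit : ae_measurable P rhs_limit.
Proof. exact: ae_measurable_cvg Rn_meas Rn_cvg. Qed.

(** Dominated convergence on both sides of [discrete_girsanov]: the left one is bounded through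
    [weight_prod_bounded], the right one because each cut is at most 1. *)
Lemma girsanov_cut :
  (\int[P]_w (lhs_limit w)%:E = (h0 Q x)%:E * \int[P]_w (rhs_limit w)%:E)%E.
Proof.
have [K KP] := weight_prod_bounded A B t0 eps0 sQ Q0.
have cvgL : (\int[P]_w (Ln n w)%:E @[n --> \oo] --> \int[P]_w (lhs_limit w)%:E)%E.
  apply: (@bounded_ae_cvg _ _ _ _ _ _ (K * H)) => //.
  - exact: lhs_limit_ge0.
  - apply: aeW => w n; apply: ler_pM => //.
      by apply: prodr_ge0 => m _; exact: weight_ge0.
    by rewrite mulr_ge0// ltW// h0_gt0.
have cvgR : (\int[P]_w (Rn n w)%:E @[n --> \oo] --> \int[P]_w (rhs_limit w)%:E)%E.
  apply: (@bounded_ae_cvg _ _ _ _ _ _ (1 * H)) => //.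
  - exact: rhs_limit_ge0.
  - apply: aeW => w n; apply: ler_pM => //.
      by apply: prodr_ge0 => m _; exact: expR_ge0.
    apply: prodr_ile1 => m _; rewrite expR_ge0 -expR0 ler_expR oppr_le0.
    by rewrite mulr_ge0// mulr_ge0 ?divr_ge0// ltW.
have LR n : (\int[P]_w (Ln n w)%:E = (h0 Q x)%:E * \int[P]_w (Rn n w)%:E)%E.
  have := @discrete_girsanov R r Q (Num.sqrt (ts n)) (fun=> drift_mx p t A n)
    (fun m => col (idx m) B) (fun m => kap t Q B n (idx m)) (quartic_cut t eps n)
    sQ _ _ _ (@continuous_quartic eps n) _ d T P (n.+1 * q)%N
    (fun m w => noise t (sample_path W w) n m) _ _ x g cg g0.
  apply.
  - by rewrite sqrtr_gt0 divr_gt0.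
  - by move=> m; exact: kap_gt0.
  - by move=> m; exact: kap_eq.
  - by move=> z; exact: expR_ge0.
  - by move=> m; exact: measurable_noise_path.
  - by move=> E mE; exact: noise_iid.
have cvgR' := cvgeZl (y := (h0 Q x)%:E) isT cvgR.
have LR' : (fun n => \int[P]_w (Ln n w)%:E)%E =
    (fun n => (h0 Q x)%:E * \int[P]_w (Rn n w)%:E)%E.
  by apply/funext => n; exact: LR.
rewrite LR' in cvgL.
exact: (cvg_unique (@ereal_hausdorff R) cvgL cvgR').
Qed.

End Truncation.

End TruncatedGirsanov.

(** * Identification of the laws *)

Section DensityMeasure.
Local Open Scope ereal_scope.
Context d (T : measurableType d) (R : realType) (mu : {measure set T -> \bar R}).
Variable v : T -> R.
Hypotheses (mv : measurable_fun setT v) (v0 : forall w, (0 <= v w)%R).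

(* The proofs are arguments, so that the measure instance can be attached. *)
Definition density_measure of measurable_fun setT v & (forall w, (0 <= v w)%R) :=
  fun A : set T => \int[mu]_(w in A) (v w)%:E.

Let nu := density_measure mv v0.

Let nu0 : nu set0 = 0. Proof. exact: integral_set0. Qed.

Let nu_ge0 A : 0 <= nu A.
Proof. by apply: integral_ge0 => w _; rewrite lee_fin. Qed.

Let nu_semi_sigma_additive : semi_sigma_additive nu.
Proof.
apply: semi_sigma_additive_nng_induced; first exact/measurable_EFinP.
by move=> w; rewrite lee_fin.
Qed.

HB.instance Definition _ := isMeasure.Build _ _ _ (density_measure mv v0)
  nu0 nu_ge0 nu_semi_sigma_additive.

End DensityMeasure.

Section WeightedLaws.
Local Open Scope ereal_scope.
Context d (T : measurableType d) (R : realType) (P : probability T R) (n : nat).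
Variables (Y Z : {RV P >-> borel_cV R n}) (v : T -> R) (c : R).
Hypotheses (mv : measurable_fun setT v) (v0 : forall w, (0 <= v w)%R).
Hypothesis c0 : (0 <= c)%R.
Hypothesis boxes : forall a b : 'cV[R]_n,
  \int[P]_w ((\1_(open_box a b) (Y w : 'cV[R]_n) * v w)%R)%:E =
  c%:E * \int[P]_w (\1_(open_box a b) (Z w : 'cV[R]_n))%:E.

Lemma weighted_law_eq (f : borel_cV R n -> \bar R) :
  measurable_fun setT f -> (forall y, 0 <= f y) ->
  \int[P]_w (f (Y w) * (v w)%:E) = c%:E * \int[P]_w f (Z w).
Proof.
move=> mf f0.
have mY : measurable_fun setT Y by [].
pose m1 : {measure set (borel_cV R n) -> \bar R} :=
  measure_function_pushforward__canonical__measure_function_Measure (density_measure P mv v0) mY.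
pose m2 : {measure set (borel_cV R n) -> \bar R} :=
  mscale (NngNum c0) (distribution P Z).
have m12_box a b : m1 (open_box a b) = m2 (open_box a b).
  transitivity (\int[P]_w ((\1_(open_box a b) (Y w : 'cV[R]_n) * v w)%R)%:E).
    rewrite [LHS]integral_mkcond; apply: eq_integral => w _.
    rewrite patchE indicE; have [/set_mem h|/negP h] := boolP (w \in _).
      by rewrite mem_set ?mul1r.
    by rewrite memNset ?mul0r// => h'; apply: h; exact/mem_set.
  rewrite boxes; congr (_ * _).
  rewrite [RHS]/(distribution P Z _) /distribution /pushforward.
  rewrite -[X in P X]setIT -integral_indic//.
  rewrite -[X in measurable X]setTI; apply: measurable_funP => //.
  exact: measurable_open_box.
have m12 U : measurable U -> m1 U = m2 U.
  apply: (@measure_unique _ R (borel_cV R n) (@open_boxes R n)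
    (fun k => open_box (const_mx (- k%:R)%R) (const_mx k%:R))).
  - exact: borel_open_boxes.
  - exact: open_boxesI.
  - by move=> k; exists (const_mx (- k%:R)%R), (const_mx k%:R).
  - exact: bigcup_open_boxes.
  - by move=> _ [a [b ->]]; exact: m12_box.
  (* Finiteness of [m1] on the exhausting boxes is read off from [m2], whose mass is at most [c]. *)
  - move=> k; rewrite m12_box; apply: le_lt_trans (ltry c).
    rewrite -[leRHS]mule1; apply: lee_wpmul2l => //.
    apply: probability_le1; exact: measurable_open_box.
transitivity (\int[m1]_y f y).
  rewrite ge0_integral_pushforward// preimage_setT.
  rewrite (ge0_integral_density (mu := P) mv v0)//.
    exact: measurableT_comp mf mY.
  by move=> w; exact: f0.
transitivity (\int[m2]_y f y).
  by apply: eq_measure_integral => U mU _; exact: m12.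
by rewrite ge0_integral_mscale//= ge0_integral_distribution.
Qed.

End WeightedLaws.

Section Bumps.
Variables (R : realType) (n : nat) (a b : 'cV[R]_n).

(** Continuous, and positive exactly on the open box, so that the truncated multiples [box_bump k]
    converge pointwise to its indicator. *)
Definition box_depth (y : 'cV[R]_n) : R :=
  \prod_i Num.max 0 (Num.min (y i 0 - a i 0) (b i 0 - y i 0)).

Definition box_bump k (y : 'cV[R]_n) : R := Num.min 1 (k%:R * box_depth y).

Lemma continuous_box_depth : continuous box_depth.
Proof.
rewrite /box_depth; elim: (index_enum _) => [|i s IH].
  by under eq_fun do rewrite big_nil; exact: continuous_cst.
under eq_fun do rewrite big_cons.
apply: continuous_mul => // y.
have cy : continuous (fun y : 'cV[R]_n => y i 0) by move=> z; exact: coord_continuous.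
apply: (@continuous_max _ _ (cst 0) (fun y : 'cV[R]_n => Num.min (y i 0 - a i 0) (b i 0 - y i 0))).
  exact: (@continuous_cst _ _ 0 y).
apply: (@continuous_min _ _ (fun y : 'cV[R]_n => y i 0 - a i 0) (fun y : 'cV[R]_n => b i 0 - y i 0)).
  by apply: continuous_sub => //; exact: continuous_cst.
by apply: continuous_sub => //; exact: continuous_cst.
Qed.

Lemma continuous_box_bump k : continuous (box_bump k).
Proof.
move=> y; apply: (@continuous_min _ _ (cst 1) (fun y => k%:R * box_depth y)).
  exact: (@continuous_cst _ _ 1 y).
by apply: continuous_mul; [exact: continuous_cst|exact: continuous_box_depth].
Qed.

Lemma box_depth_ge0 y : 0 <= box_depth y.
Proof. by apply: prodr_ge0 => i _; rewrite le_max lexx. Qed.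

Lemma box_bump_ge0 k y : 0 <= box_bump k y.
Proof. by rewrite /box_bump le_min ler01 mulr_ge0// box_depth_ge0. Qed.

Lemma box_bump_le1 k y : box_bump k y <= 1.
Proof. by rewrite /box_bump ge_min lexx. Qed.

Lemma cvg_box_bump y : box_bump k y @[k --> \oo] --> (\1_(open_box a b) y : R).
Proof.
rewrite indicE; have [/set_mem yU|/negP yU] := boolP (y \in _).
  have d0 : 0 < box_depth y.
    apply: prodr_gt0 => i _; rewrite lt_max lt_min !subr_gt0.
    by have /andP[-> ->] := yU i; rewrite orbT.
  apply: cvg_near_cst; near=> k; rewrite /box_bump min_l//.
  rewrite -ler_pdivrMr// mul1r.
  by near: k; exact: nbhs_infty_ger.
suff d0 : box_depth y = 0.
  by rewrite /box_bump d0; under eq_fun do rewrite mulr0 min_r//; exact: cvg_cst.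
have [i yi] : exists i, ~ (a i 0 < y i 0 < b i 0).
  by apply: contrapT => h; apply: yU; apply/mem_set => i; apply: contrapT => h'; apply: h; exists i.
rewrite /box_depth (bigD1 i)//= [X in X * _]max_l ?mul0r//.
by move: yi => /negP; rewrite negb_and -!leNgt ge_min !subr_le0.
Unshelve. all: by end_near. Qed.

End Bumps.

Section Girsanov.
Context d (T : measurableType d) (R : realType) (P : probability T R).
Variables (r p : nat) (t : R) (A Rm Sm Q : 'M[R]_r) (B : 'M[R]_(r, p.+1)).
Variables (x : 'cV[R]_r) (W : process P p.+1) (X Xh : process P r).
Local Notation q := p.+1.
Local Notation mu := (@lebesgue_measure R).
Hypotheses (t0 : 0 < t) (sQ : Q^T = Q).
Hypothesis Q0 : forall z, 0 <= quad_form Q z.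
Hypothesis S0 : forall z, 0 <= quad_form Sm z.
Hypothesis BB : B *m B^T = Rm.
Hypothesis riccati : A^T *m Q + Q *m A - Q *m Rm *m Q + Sm = 0.
Hypothesis BM : brownian_motion W.
Hypothesis solX : linear_sde_solution A B W x X.
Hypothesis solH : linear_sde_solution (A - Rm *m Q) B W x Xh.

Let lam := 2^-1 * \tr (Rm *m Q).

Definition fk_density (w : T) : R :=
  expR (lam * t - \int[mu]_(s in `[0, t]) potential Sm (clamped_path X w s)).

Let eps k : R := k.+1%:R^-1.

Let eps0 k : 0 < eps k. Proof. by rewrite invr_gt0. Qed.

Let cvg_eps_mul (c : R) : eps k * c @[k --> \oo] --> 0.
Proof.
rewrite -[X in _ --> X](mul0r c); apply: cvgM; last exact: cvg_cst.
exact: cvg_harmonic.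
Qed.

Let lhs_limit_split e g w : continuous (clamped_path X w) ->
  lhs_limit p t Rm Sm Q X e g w =
  expR (lam * t - (\int[mu]_(s in `[0, t]) potential Sm (clamped_path X w s) +
    e * (q%:R * \int[mu]_(s in `[0, t]) `|clamped_path X w s| ^+ 4))) *
  (g (clamped_path X w t) * h0 Q (clamped_path X w t)).
Proof.
move=> cX; rewrite /lhs_limit; congr (expR (_ - _) * _).
have cpot : continuous (fun s => potential Sm (clamped_path X w s)).
  apply: continuous_mul; first exact: continuous_cst.
  by move=> s; apply: continuous_comp; [exact: cX|exact: continuous_quad_form].
have c4 : continuous (fun s => `|clamped_path X w s| ^+ 4).
  apply: continuous_pow => s; apply: continuous_comp; first exact: cX.
  exact: norm_continuous.
rewrite RintegralD//.
- by rewrite RintegralZl//= ?mulrA//; exact: integrable_continuous.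
- exact: integrable_continuous.
- apply: integrable_continuous; apply: continuous_mul => //; exact: continuous_cst.
Qed.

Let lhs_limit_cvg (g : nat -> 'cV[R]_r -> R) (gl : 'cV[R]_r -> R) w :
  continuous (clamped_path X w) -> (forall y, g k y @[k --> \oo] --> gl y) ->
  lhs_limit p t Rm Sm Q X (eps k) (g k) w @[k --> \oo] -->
  fk_density w * (gl (clamped_path X w t) * h0 Q (clamped_path X w t)).
Proof.
move=> cX gk; under eq_fun do rewrite lhs_limit_split//.
apply: cvgM; last by apply: cvgM; [exact: gk|exact: cvg_cst].
apply: cvg_comp_continuous; first exact: continuous_expR.
apply: (@cvgB _ R^o); first exact: cvg_cst.
rewrite -[X in _ --> X]addr0; apply: (@cvgD _ R^o); first exact: cvg_cst.
exact: cvg_eps_mul.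
Qed.

(** The test function [1 / h0] cancels the terminal factor of [lhs_limit], so the density is a limit
    of functionals already known to be almost everywhere measurable. *)
Lemma ae_measurable_fk_density : ae_measurable P fk_density.
Proof.
have h0inv y : (h0 Q y)^-1 * h0 Q y = 1 by rewrite mulVf// gt_eqF// h0_gt0.
apply: (@ae_measurable_cvg _ _ _ _ (fun k => lhs_limit p t Rm Sm Q X (eps k)
    (fun y => (h0 Q y)^-1))) => [k|].
  apply: (ae_measurable_lhs_limit t0 sQ Q0 BB riccati BM solX).
  by apply: continuous_inv => [y|]; [rewrite gt_eqF// h0_gt0|exact: continuous_h0].
apply: filterS (clamped_solution BM solX) => w [_ cX _ _].
rewrite -[fk_density w]mulr1 -(h0inv (clamped_path X w t)).
apply: (lhs_limit_cvg (g := fun _ y => (h0 Q y)^-1) (gl := fun y => (h0 Q y)^-1)) => // y.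
exact: cvg_cst.
Qed.

Let h0_le1 y : h0 Q y <= 1.
Proof. by rewrite -expR0 ler_expR oppr_le0 mulr_ge0. Qed.

(** The cut and the bump are removed together, as [k] grows. As [V >= 0] and [h0 <= 1], the
    constants [exp (lam t)] on the left and 1 on the right dominate. *)
Lemma girsanov_box (a b : 'cV[R]_r) :
  (\int[P]_w (fk_density w *
     (\1_(open_box a b) (clamped_path X w t) * h0 Q (clamped_path X w t)))%:E =
   (h0 Q x)%:E * \int[P]_w (\1_(open_box a b) (clamped_path Xh w t))%:E)%E.
Proof.
have g1 k y : box_bump a b k y * h0 Q y <= 1.
  by apply: mulr_ile1; rewrite ?box_bump_ge0 ?box_bump_le1 ?h0_le1// ltW// h0_gt0.
have cvgL : (\int[P]_w (lhs_limit p t Rm Sm Q X (eps k) (box_bump a b k) w)%:E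
    @[k --> \oo] --> \int[P]_w (fk_density w *
      (\1_(open_box a b) (clamped_path X w t) * h0 Q (clamped_path X w t)))%:E)%E.
  apply: (@bounded_ae_cvg _ _ _ _ _ _ (expR (lam * t) * 1)).
  - move=> k; apply: (ae_measurable_lhs_limit t0 sQ Q0 BB riccati BM solX).
    exact: continuous_box_bump.
  - by move=> k w; apply: lhs_limit_ge0 => // y; exact: box_bump_ge0.
  - move=> w; rewrite mulr_ge0 ?expR_ge0// mulr_ge0 ?indicE ?ler0n//.
    by rewrite ltW// h0_gt0.
  - apply: aeW => w k; apply: ler_pM; rewrite ?expR_ge0//.
      by rewrite mulr_ge0 ?box_bump_ge0// ltW// h0_gt0.
    rewrite ler_expR gerBl; apply: Rintegral_ge0 => s _.
    by rewrite addr_ge0 ?mulr_ge0// ?exprn_ge0// ltW.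
  - apply: filterS (clamped_solution BM solX) => w [_ cX _ _].
    by apply: lhs_limit_cvg => // y; exact: cvg_box_bump.
have cvgR : (\int[P]_w (rhs_limit p t Xh (eps k) (box_bump a b k) w)%:E
    @[k --> \oo] --> \int[P]_w (\1_(open_box a b) (clamped_path Xh w t))%:E)%E.
  apply: (@bounded_ae_cvg _ _ _ _ _ _ (1 * 1)).
  - move=> k; apply: (ae_measurable_rhs_limit t0 Q0 BB BM solH).
    exact: continuous_box_bump.
  - by move=> k w; apply: rhs_limit_ge0 => y; exact: box_bump_ge0.
  - by move=> w; rewrite indicE ler0n.
  - apply: aeW => w k; apply: ler_pM; rewrite ?expR_ge0 ?box_bump_ge0 ?box_bump_le1//.
    rewrite -expR0 ler_expR oppr_le0 mulr_ge0// ?mulr_ge0//; first exact: ltW.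
    by apply: Rintegral_ge0 => s _; exact: exprn_ge0.
  - apply: aeW => w; rewrite -[X in _ --> X]mul1r.
    apply: cvgM; last exact: cvg_box_bump.
    rewrite -expR0; apply: cvg_comp_continuous; first exact: continuous_expR.
    rewrite -[X in _ --> X]oppr0; apply: (@cvgN _ R^o).
    by under eq_fun do rewrite -mulrA; exact: cvg_eps_mul.
have cvgR' := cvgeZl (y := (h0 Q x)%:E) isT cvgR.
apply: (cvg_unique (@ereal_hausdorff R) _ cvgR').
have <- : (fun k => \int[P]_w (lhs_limit p t Rm Sm Q X (eps k) (box_bump a b k) w)%:E)%E =
    (fun k => (h0 Q x)%:E * \int[P]_w (rhs_limit p t Xh (eps k) (box_bump a b k) w)%:E)%E.
  apply/funext => k.
  exact: (girsanov_cut t0 sQ Q0 BB riccati BM solX solH (eps0 k)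
    (@continuous_box_bump _ _ a b k) (@box_bump_ge0 _ _ a b k)
    (@box_bump_le1 _ _ a b k) (g1 k)).
exact: cvgL.
Qed.

End Girsanov.

(** * The h-transform identity *)

Section FeynmanKac.
Context d (T : measurableType d) (R : realType) (P : probability T R).
Variables (r : nat) (Q : 'M[R]_r).

Lemma integral_distribution_h0 (Y : {RV P >-> borel_cV R r}) (E : set (borel_cV R r)) :
  measurable E ->
  (\int[distribution P Y]_(y in E) ((h0 Q y)^-1)%:E =
   \int[P]_w (\1_E (Y w) * (h0 Q (Y w))^-1)%:E)%E.
Proof.
move=> mE.
have mf : measurable_fun setT (fun y : borel_cV R r => (\1_E y * (h0 Q y)^-1)%:E).
  apply/measurable_EFinP; apply: measurable_funM; first exact: measurable_indic.
  apply: continuous_measurable_cV; apply: continuous_inv; last exact: continuous_h0.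
  by move=> y; rewrite gt_eqF// h0_gt0.
rewrite integral_mkcond (_ : _ \_ _ = fun y => (\1_E y * (h0 Q y)^-1)%:E).
  rewrite ge0_integral_distribution// => y.
  by rewrite lee_fin mulr_ge0 ?indicE// invr_ge0 ltW// h0_gt0.
apply/funext => y; rewrite patchE indicE.
by case: ifP; rewrite ?mul1r ?mul0r.
Qed.

Lemma linear_sde_solution0 n (F : 'M[R]_r) (B : 'M[R]_(r, n)) W x (Y : process P r) :
  brownian_motion W -> linear_sde_solution F B W x Y ->
  {ae P, forall w, sample_path Y w 0 = x}.
Proof.
move=> [W0 _ _ _] [_ sol]; apply: filterS2 W0 sol => w W0 /(_ 0 (lexx _)) ->.
rewrite W0 mulmx0 addr0 set_itv1 -[RHS]addr0; congr (_ + _).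
by apply/matrixP => i j; rewrite !mxE Rintegral_set1.
Qed.

Variables (p : nat) (A Rm Sm : 'M[R]_r) (B : 'M[R]_(r, p.+1)).
Variables (x : 'cV[R]_r) (W : process P p.+1) (X Xh : process P r).
Hypotheses (sQ : Q^T = Q).
Hypothesis Q0 : forall z, 0 <= quad_form Q z.
Hypothesis S0 : forall z, 0 <= quad_form Sm z.
Hypothesis BB : B *m B^T = Rm.
Hypothesis riccati : A^T *m Q + Q *m A - Q *m Rm *m Q + Sm = 0.
Hypothesis BM : brownian_motion W.
Hypothesis solX : linear_sde_solution A B W x X.
Hypothesis solH : linear_sde_solution (A - Rm *m Q) B W x Xh.

Let lam := 2^-1 * \tr (Rm *m Q).

Lemma feynman_kac_h_transform t (E : set (borel_cV R r)) : 0 <= t -> measurable E ->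
  ((expR (lam * t))%:E * FK_kernel Sm X t E =
   (h0 Q x)%:E * \int[distribution P (Xh t)]_(y in E) ((h0 Q y)^-1)%:E)%E.
Proof.
move=> t0 mE; rewrite integral_distribution_h0//.
have h00 y : 0 <= h0 Q y by rewrite ltW// h0_gt0.
have ind0 (U : set 'cV[R]_r) y : 0 <= \1_U y :> R by rewrite indicE ler0n.
have intg_ge0 y : (0 <= (\1_E y * (h0 Q y)^-1)%:E)%E.
  by rewrite lee_fin mulr_ge0 ?invr_ge0.
(* The grid requires [t > 0]; at time 0 both sides are evaluated at the starting point. *)
move: t0; rewrite le_eqVlt => /predU1P[<-|t0].
  have -> : FK_kernel Sm X 0 E = (\1_E x)%:E.
    apply: ge0_ae_integral_cst => [w||]; [|by rewrite lee_fin|].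
      by rewrite mule_ge0 ?lee_fin ?expR_ge0.
    apply: filterS (linear_sde_solution0 BM solX) => w ->.
    by rewrite set_itv1 Rintegral_set1 oppr0 expR0 mule1.
  have -> : (\int[P]_w (\1_E (Xh 0 w) * (h0 Q (Xh 0 w))^-1)%:E =
      (\1_E x * (h0 Q x)^-1)%:E)%E.
    apply: ge0_ae_integral_cst; [by move=> w; exact: intg_ge0|exact: intg_ge0|].
    apply: filterS (linear_sde_solution0 BM solH) => w.
    by rewrite /sample_path => ->.
  by rewrite mulr0 expR0 mul1e -EFinM mulrCA mulfV ?mulr1// gt_eqF// h0_gt0.
have [v mv vE] := ae_measurable_fk_density t0 sQ Q0 BB riccati BM solX.
have mh0 (f : 'cV[R]_r -> R) : continuous f -> measurable_fun setT (fun w => f (X t w)).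
  by move=> cf; apply: measurableT_comp (continuous_measurable_cV cf) _.
have vabsE : {ae P, forall w, `|v w| = fk_density t Rm Sm Q X w}.
  by apply: filterS vE => w ->; rewrite ger0_norm// expR_ge0.
have mvh : measurable_fun setT (fun w => `|v w| * h0 Q (X t w)).
  apply: measurable_funM; first exact: measurableT_comp.
  by apply: mh0; exact: continuous_h0.
have vh0 w : 0 <= `|v w| * h0 Q (X t w) by rewrite mulr_ge0.
have boxes a b : (\int[P]_w (\1_(open_box a b) (X t w : 'cV[R]_r) *
      (`|v w| * h0 Q (X t w)))%:E =
    (h0 Q x)%:E * \int[P]_w (\1_(open_box a b) (Xh t w : 'cV[R]_r))%:E)%E.
  have Xt (Y : process P r) w : clamped_path Y w t = Y t w.
    by rewrite clamped_pathE// ltW.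
  have -> : (fun w => (\1_(open_box a b) (Xh t w : 'cV[R]_r))%:E) =
      (fun w => (\1_(open_box a b) (clamped_path Xh w t))%:E :> \bar R).
    by apply/funext => w; rewrite Xt.
  rewrite -(girsanov_box t0 sQ Q0 S0 BB riccati BM solX solH a b).
  apply: ge0_ae_integral => [w|w|].
  - by rewrite lee_fin mulr_ge0.
  - by rewrite lee_fin !mulr_ge0// expR_ge0.
  - by apply: filterS vabsE => w ->; rewrite Xt mulrCA.
(* With the test function [1_E / h0], the factor [h0 (X t)] of the density cancels and the
   Feynman-Kac weight is left. *)
have := @weighted_law_eq _ _ _ _ _ (X t) (Xh t) _ _ mvh vh0 (h00 x) boxes
  (fun y => (\1_E y * (h0 Q y)^-1)%:E) _ intg_ge0.
move=> <-; last first.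
  apply/measurable_EFinP; apply: measurable_funM; first exact: measurable_indic.
  apply: continuous_measurable_cV; apply: continuous_inv; last exact: continuous_h0.
  by move=> y; rewrite gt_eqF// h0_gt0.
have mXE : measurable_fun setT (fun w => \1_E (X t w) * `|v w|).
  apply: measurable_funM; last exact: measurableT_comp.
  by apply: measurableT_comp; [exact: measurable_indic|exact: measurable_funP].
have -> : FK_kernel Sm X t E =
    (\int[P]_w ((expR (- (lam * t)))%:E * (\1_E (X t w) * `|v w|)%:E))%E.
  apply: ge0_ae_integral => [w|w|].
  - by rewrite mule_ge0 ?lee_fin ?expR_ge0.
  - by rewrite mule_ge0 ?lee_fin ?mulr_ge0 ?expR_ge0.
  apply: filterS vabsE => w ->; rewrite -!EFinM; congr EFin.
  rewrite mulrCA /fk_density -expRD addrA addNr add0r; congr (_ * expR (- _)).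
  by rewrite eq_Rintegral_clamped.
rewrite ge0_integralZl//; last exact/measurable_EFinP.
rewrite muleA -EFinM -expRD addrN expR0 mul1e; apply: eq_integral => w _.
by rewrite -EFinM; congr EFin; rewrite mulrACA mulVf ?mulr1// gt_eqF// h0_gt0.
Qed.

End FeynmanKac.

Unset Implicit Arguments.

Theorem theorem3p1
  (R : realType) (r : nat) (r_gt0 : (0 < r)%N)
  (A Rm Sm : 'M[R]_r) (Rm_psd : psdmx Rm) (Sm_psd : psdmx Sm)
  (ARS_rank : rank_condition A Rm Sm)
  (Pinf Qinf : 'M[R]_r)
  (PinfP : is_Pinfty A Rm Sm Pinf) (QinfP : is_Qinfty A Rm Sm Qinf) :
  let lambda0 := 2^-1 * \tr (Sm *m Pinf) in
  [/\ lambda0 = 2^-1 * \tr (Rm *m Qinf),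
      0 < lambda0,
      twice_differentiable (h0 Qinf) &
      forall x : 'cV[R]_r,
        hamiltonian A Rm Sm (h0 Qinf) x = lambda0 * h0 Qinf x] /\
  forall (r1 : nat) (B : 'M[R]_(r, r1)), B *m B^T = Rm ->
  forall (d : measure_display) (T : measurableType d) (P : probability T R)
    (W : process P r1), brownian_motion W ->
  forall (x : 'cV[R]_r) (X Xh : process P r),
    linear_sde_solution A B W x X ->
    linear_sde_solution (A - Rm *m Qinf) B W x Xh ->
  forall (t : R), 0 <= t ->
  forall (E : set (borel_cV R r)), measurable E ->
    ((expR (lambda0 * t))%:E * FK_kernel Sm X t E
     = (h0 Qinf x)%:E *
       \int[distribution P (Xh t)]_(y in E) ((h0 Qinf y)^-1)%:E)%E.
Proof.
move=> lambda0.
have sR : Rm^T = Rm by case: Rm_psd.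
have trE : \tr (Sm *m Pinf) = \tr (Rm *m Qinf) by exact: (riccati_trace sR PinfP QinfP).
have [pdQ riccati] := QinfP; have sQ : Qinf^T = Qinf by case: pdQ.
have tr_gt0 : 0 < \tr (Rm *m Qinf) by exact: (riccati_trace_gt0 r_gt0 pdQ ARS_rank.1).
rewrite /lambda0 trE; split.
  split => //; first by rewrite mulr_gt0// invr_gt0.
    exact: twice_differentiable_h0.
  by move=> x; exact: hamiltonian_h0.
move=> [|p] B BB d T P W BM x X Xh solX solH t t0 E mE.
  (* Without noise columns [Rm = B B'] would vanish, against the positive trace; so the number of
     columns can be taken of the form [p.+1]. *)
  by move: tr_gt0; rewrite -BB [B]thinmx0 mul0mx mul0mx mxtrace0 ltxx.
apply: (feynman_kac_h_transform sQ _ Sm_psd.2 BB riccati BM solX solH t0 mE) => z.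
have [->|z0] := eqVneq z 0; first by rewrite /quad_form mulmx0 mxE.
by apply: ltW; exact: pdQ.2.
Qed.
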